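(* The algebra $U_q^{T,+}$ has a presentation of Freidel-Maillet type. Namely, let $\bar k_\pm\in\mathbb C(q)$ be such that $\bar\rho=\bar k_+\bar k_-(q+q^{-1})^2$ and let $K(u)$ be the square matrix $$K(u)=\begin{pmatrix} uq\,\mathcal Y_+(u) & \frac{1}{\bar k_-(q+q^{-1})}\mathcal Z_+(u)+\frac{\bar k_+(q+q^{-1})}{q-q^{-1}}\\ \frac{1}{\bar k_+(q+q^{-1})}\mathcal Z_-(u)+\frac{\bar k_-(q+q^{-1})}{q-q^{-1}} & uq\,\mathcal Y_-(u)\end{pmatrix}.$$ Then $U_q^{T,+}$ is presented by the generators $\{y^+_{-k},y^+_{k+1},z^+_{k+1},\tilde z^+_{k+1}\mid k\in\mathbb N\}$ (the coefficients of the generating functions entering $K(u)$) with defining relations $$R(u/v)\,(K(u)\otimes\mathbb I)\,R^{(0)}\,(\mathbb I\otimes K(v))=(\mathbb I\otimes K(v))\,R^{(0)}\,(K(u)\otimes\mathbb I)\,R(u/v)$$ and $$\mathrm{tr}_{12}\big(P^-_{12}\,(K(u)\otimes\mathbb I)\,R^{(0)}\,(\mathbb I\otimes K(uq))\big)=-\frac{\bar\rho}{(q-q^{-1})^2}.$$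
   Context: Notation: $\mathbb N=\{0,1,2,\dots\}$; $q$ is an indeterminate and the base field is $\mathbb C(q)$; $[X,Y]=XY-YX$, $[X,Y]_q=qXY-q^{-1}YX$; $\bar\rho=q^{-1}(q^2-q^{-2})^2$. $U_q^{T,+}$ is the unital associative $\mathbb C(q)$-algebra with generators $\{y^+_{-k},y^+_{k+1},z^+_{k+1},\tilde z^+_{k+1}\mid k\in\mathbb N\}$ and the following relations for all $k,\ell\in\mathbb N$: $[y^+_1,y^+_{-k}]=[y^+_{k+1},y^+_0]=\frac{z^+_{k+1}-\tilde z^+_{k+1}}{q+q^{-1}}$; $[y^+_1,\tilde z^+_{k+1}]_q=[z^+_{k+1},y^+_1]_q=\bar\rho\, y^+_{k+2}$; $[\tilde z^+_{k+1},y^+_0]_q=[y^+_0,z^+_{k+1}]_q=\bar\rho\, y^+_{-k-1}$; $[y^+_{k+1},y^+_{\ell+1}]=0$, $[y^+_{-k},y^+_{-\ell}]=0$; $[y^+_{k+1},y^+_{-\ell}]+[y^+_{-k},y^+_{\ell+1}]=0$; $[y^+_{k+1},\tilde z^+_{\ell+1}]+[\tilde z^+_{k+1},y^+_{\ell+1}]=0$; $[y^+_{k+1},z^+_{\ell+1}]+[z^+_{k+1},y^+_{\ell+1}]=0$; $[y^+_{-k},\tilde z^+_{\ell+1}]+[\tilde z^+_{k+1},y^+_{-\ell}]=0$; $[y^+_{-k},z^+_{\ell+1}]+[z^+_{k+1},y^+_{-\ell}]=0$; $[\tilde z^+_{k+1},\tilde z^+_{\ell+1}]=0$, $[z^+_{k+1},z^+_{\ell+1}]=0$;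 $[z^+_{k+1},\tilde z^+_{\ell+1}]+[\tilde z^+_{k+1},z^+_{\ell+1}]=0$; and, with $z^+_0=\tilde z^+_0=\bar\rho/(q-q^{-1})$, for all $n\ge 0$, $$\bar\rho(q+q^{-1})\sum_{k=0}^n q^{-n+2k}y^+_{k+1}y^+_{-n+k}-\sum_{k=0}^{n+1}q^{2k-n-1}z^+_k\tilde z^+_{n+1-k}=0.$$ Generating functions, with $U=qu^2/(q+q^{-1})$: $\mathcal Y_+(u)=\sum_{k\in\mathbb N}y^+_{k+1}U^{-k-1}$, $\mathcal Y_-(u)=\sum_{k\in\mathbb N}y^+_{-k}U^{-k-1}$, $\mathcal Z_+(u)=\sum_{k\in\mathbb N}\tilde z^+_{k+1}U^{-k-1}$, $\mathcal Z_-(u)=\sum_{k\in\mathbb N}z^+_{k+1}U^{-k-1}$. Matrices acting on $\mathbb C^2\otimes\mathbb C^2$: $$R(u)=\begin{pmatrix} uq-u^{-1}q^{-1}&0&0&0\\0&u-u^{-1}&q-q^{-1}&0\\0&q-q^{-1}&u-u^{-1}&0\\0&0&0&uq-u^{-1}q^{-1}\end{pmatrix},\qquad R^{(0)}=\mathrm{diag}(1,q^{-1},q^{-1},1).$$ $P=R(1)/(q-q^{-1})$ is the permutation operator, $P^-_{12}=(1-P)/2$, $\mathrm{tr}_{12}$ is the trace over $\mathbb C^2\otimes\mathbb C^2$, and $\mathbb I$ is the $2\times2$ identity matrix. All identities are understood as identities of formal Laurent series in the indeterminates $u,v$, with coefficients compared. *)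

(* Defs.v *)
From HB Require Import structures.
From mathcomp Require Import all_boot all_order all_algebra.
From mathcomp Require Import boolp classical_sets functions cardinality fsbigop.
From mathcomp Require Import reals complex mxtens ring lra zify.
From mathcomp.multinomials Require Import monalg.

Set Implicit Arguments.
Unset Strict Implicit.
Unset Printing Implicit Defensive.

Import Order.TTheory GRing.Theory Num.Theory.

Local Open Scope ring_scope.

(* Formal Laurent series \sum_n f_n u^n over a possibly noncommutative ring, *)
(* with u central. All series at hand are power series in u^-1 up to finitely *)
(* many terms, so it is the positive exponents that are bounded.             *)
Record laurent (A : zmodType) := Laurent {
  lcoef :> int -> A;
  lcoef_bnd : exists N : int, forall n, N < n -> lcoef n = 0 }.

HB.instance Definition _ (A : zmodType) := gen_eqMixin (laurent A).
HB.instance Definition _ (A : zmodType) := gen_choiceMixin (laurent A).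

Lemma laurentP (A : zmodType) (f g : laurent A) : f =1 g <-> f = g.
Proof.
split=> [|->//]; case: f g => [f f_bnd] [g g_bnd] /= /funext fg.
by case: _ / fg g_bnd => g_bnd; congr Laurent; exact: Prop_irrelevance.
Qed.

Section LaurentZmod.
Variable A : zmodType.
Implicit Types f g : laurent A.

Fact laurent0_bnd : exists N : int, forall n, N < n -> 0 = 0 :> A.
Proof. by exists 0. Qed.
Definition laurent0 := Laurent laurent0_bnd.

Fact laurent_opp_bnd f : exists N : int, forall n, N < n -> - f n = 0.
Proof. by have [N fN] := lcoef_bnd f; exists N => n /fN->; rewrite oppr0. Qed.
Definition laurent_opp f := Laurent (laurent_opp_bnd f).

Fact laurent_add_bnd f g : exists N : int, forall n, N < n -> f n + g n = 0.
Proof.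
have [[M fM] [N gN]] := (lcoef_bnd f, lcoef_bnd g).
exists (Num.max M N) => n; rewrite gt_max => /andP[/fM-> /gN->].
by rewrite addr0.
Qed.
Definition laurent_add f g := Laurent (laurent_add_bnd f g).

Fact laurent_addA : associative laurent_add.
Proof. by move=> f g h; apply/laurentP => n /=; rewrite addrA. Qed.
Fact laurent_addC : commutative laurent_add.
Proof. by move=> f g; apply/laurentP => n /=; rewrite addrC. Qed.
Fact laurent_add0 : left_id laurent0 laurent_add.
Proof. by move=> f; apply/laurentP => n /=; rewrite add0r. Qed.
Fact laurent_addN : left_inverse laurent0 laurent_opp laurent_add.
Proof. by move=> f; apply/laurentP => n /=; rewrite addNr. Qed.

HB.instance Definition _ := GRing.isZmodule.Build (laurent A)
  laurent_addA laurent_addC laurent_add0 laurent_addN.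

Lemma lcoef0 n : (0 : laurent A) n = 0. Proof. by []. Qed.
Lemma lcoefN f n : (- f) n = - f n. Proof. by []. Qed.
Lemma lcoefD f g n : (f + g) n = f n + g n. Proof. by []. Qed.

Fact lmono_bnd (k : int) (a : A) :
  exists N : int, forall n, N < n -> (if n == k then a else 0) = 0.
Proof. by exists k => n /gt_eqF->. Qed.
(* a u^k *)
Definition lmono k a : laurent A := Laurent (lmono_bnd k a).

End LaurentZmod.

Section LaurentRing.
Variable A : nzRingType.
Implicit Types f g h : laurent A.

Fact lmul_key : unit. Proof. by []. Qed.
Definition lmul_coef f g : int -> A := locked_with lmul_key
  (fun n => \sum_(i \in [set: int]) f i * g (n - i)).

Lemma lmul_coef_unlock f g n :
  lmul_coef f g n = \sum_(i \in [set: int]) f i * g (n - i).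
Proof. by rewrite /lmul_coef unlock. Qed.

Lemma lmul_coefE f g (M N : int) (k K : nat) :
    (forall n, M < n -> f n = 0) -> (forall n, N < n -> g n = 0) -> (k < K)%N ->
  lmul_coef f g (M + N - k%:Z) =
  (\poly_(i < K) f (M - i%:Z) * \poly_(i < K) g (N - i%:Z))`_k.
Proof.
move=> fM gN kK; rewrite lmul_coef_unlock coefM.
pose s := [seq M - j%:Z | j <- iota 0 k.+1].
rewrite -(fsbig_widen [set` s] setT) //=; last first.
  move=> i [_ /= /negP si].
  have [/fM->|iM] := ltP M i; first by rewrite mul0r.
  have [/gN->|ni] := ltP N (M + N - k%:Z - i); first by rewrite mulr0.
  case/negP: si; apply/mapP; exists (absz (M - i)); last first.
    by rewrite gez0_abs ?subr_ge0 // opprB addrC subrK.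
  rewrite mem_iota /= add0n ltnS -lez_nat gez0_abs ?subr_ge0 //.
  by lia.
rewrite -fsbig_seq; last first.
  by rewrite map_inj_uniq ?iota_uniq // => a b /= ?; lia.
rewrite /s big_map -[iota 0 _]/(index_iota 0 k.+1) big_mkord.
apply: eq_bigr => j _; have jk := ltn_ord j; rewrite ltnS in jk.
rewrite !coef_poly (leq_ltn_trans jk kK) (leq_ltn_trans (leq_subr _ _) kK).
by congr (_ * g _); lia.
Qed.

Fact lmul_bnd f g : exists N : int, forall n, N < n -> lmul_coef f g n = 0.
Proof.
have [[M fM] [N gN]] := (lcoef_bnd f, lcoef_bnd g); exists (M + N) => n nMN.
rewrite lmul_coef_unlock; apply: fsbig1 => i _; have [/fM->|iM] := ltP M i; first by rewrite mul0r.
by rewrite [g _]gN ?mulr0 //; lia.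
Qed.
Definition lmul f g := Laurent (lmul_bnd f g).

Definition lone : laurent A := lmono 0 1.

Lemma lmono_mul_coef k a f n : lmul_coef (lmono k a) f n = a * f (n - k).
Proof.
rewrite lmul_coef_unlock -(fsbig_widen [set k]%classic setT) //=; last first.
  by move=> i [_ /eqP/negPf /= ->]; rewrite mul0r.
by rewrite fsbig_set1 /= eqxx.
Qed.

Lemma lmul_mono_coef k a f n : lmul_coef f (lmono k a) n = f (n - k) * a.
Proof.
rewrite lmul_coef_unlock -(fsbig_widen [set n - k]%classic setT) //=; last first.
  move=> i [_ /eqP /= ik]; rewrite ifF ?mulr0 //; apply/eqP; lia.
by rewrite fsbig_set1 /= ifT //; apply/eqP; lia.
Qed.

Let coefMl (p p' r : {poly A}) k :
  (forall j, (j <= k)%N -> p`_j = p'`_j) -> (p * r)`_k = (p' * r)`_k.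
Proof.
by move=> pp'; rewrite !coefM; apply: eq_bigr => j _; rewrite pp' -1?ltnS.
Qed.

Let coefMr (p r r' : {poly A}) k :
  (forall j, (j <= k)%N -> r`_j = r'`_j) -> (p * r)`_k = (p * r')`_k.
Proof.
by move=> rr'; rewrite !coefM; apply: eq_bigr => j _; rewrite rr' // leq_subr.
Qed.

Fact lmulA : associative lmul.
Proof.
move=> f g h; apply/laurentP => n.
have [[M fM] [N gN]] := (lcoef_bnd f, lcoef_bnd g).
have [L hL] := lcoef_bnd h.
have fgMN m : M + N < m -> lmul f g m = 0.
  move=> mMN; rewrite /= lmul_coef_unlock; apply: fsbig1 => i _.
  have [/fM->|iM] := ltP M i; first by rewrite mul0r.
  by rewrite [g _]gN ?mulr0 //; lia.
have ghNL m : N + L < m -> lmul g h m = 0.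
  move=> mNL; rewrite /= lmul_coef_unlock; apply: fsbig1 => i _.
  have [/gN->|iN] := ltP N i; first by rewrite mul0r.
  by rewrite [h _]hL ?mulr0 //; lia.
have [nb|nb] := ltP (M + N + L) n.
  rewrite /= !lmul_coef_unlock !fsbig1 // => i _.
    have [/fgMN/= ->|iM] := ltP (M + N) i; first by rewrite mul0r.
    by rewrite [h _]hL ?mulr0 //; lia.
  have [/fM->|iM] := ltP M i; first by rewrite mul0r.
  by rewrite ghNL ?mulr0 //; lia.
pose k := absz (M + N + L - n)%R; have kE : k%:Z = M + N + L - n by lia.
have -> : n = M + (N + L) - k%:Z by lia.
rewrite /= (lmul_coefE fM ghNL (ltnSn k)).
have -> : M + (N + L) - k%:Z = (M + N) + L - k%:Z by lia.
rewrite (lmul_coefE fgMN hL (ltnSn k)).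
set pf := \poly_(i < k.+1) f (M - i%:Z).
set pg := \poly_(i < k.+1) g (N - i%:Z).
set ph := \poly_(i < k.+1) h (L - i%:Z).
transitivity (pf * (pg * ph))`_k.
  apply: coefMr => j jk; rewrite coef_poly ltnS jk.
  by rewrite /= (lmul_coefE (K := k.+1) gN hL).
rewrite mulrA; apply: coefMl => j jk; rewrite coef_poly ltnS jk.
by rewrite /= (lmul_coefE (K := k.+1) fM gN).
Qed.

Fact lmul1 : left_id lone lmul.
Proof.
by move=> f; apply/laurentP => n; rewrite /= lmono_mul_coef mul1r subr0.
Qed.

Fact lmulr1 : right_id lone lmul.
Proof.
by move=> f; apply/laurentP => n; rewrite /= lmul_mono_coef mulr1 subr0.
Qed.

Fact lmulDl : left_distributive lmul +%R.
Proof.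
move=> f g h; apply/laurentP => n; rewrite lcoefD.
have [[M fM] [N gN]] := (lcoef_bnd f, lcoef_bnd g).
have [L hL] := lcoef_bnd h.
pose B := Num.max (Num.max M N) (n - L).
have fB m : B < m -> f m = 0 by move=> ?; apply: fM; lia.
have gB m : B < m -> g m = 0 by move=> ?; apply: gN; lia.
have fgB m : B < m -> (f + g) m = 0 by move=> ?; rewrite lcoefD fB ?gB ?addr0.
pose k := absz (B + L - n)%R.
have -> : n = B + L - k%:Z by lia.
rewrite /= !(lmul_coefE (K := k.+1) _ hL) // -coefD -mulrDl.
by apply: coefMl => j jk; rewrite coefD !coef_poly ltnS jk.
Qed.

Fact lmulDr : right_distributive lmul +%R.
Proof.
move=> h f g; apply/laurentP => n; rewrite lcoefD.
have [[M fM] [N gN]] := (lcoef_bnd f, lcoef_bnd g).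
have [L hL] := lcoef_bnd h.
pose B := Num.max (Num.max M N) (n - L).
have fB m : B < m -> f m = 0 by move=> ?; apply: fM; lia.
have gB m : B < m -> g m = 0 by move=> ?; apply: gN; lia.
have fgB m : B < m -> (f + g) m = 0 by move=> ?; rewrite lcoefD fB ?gB ?addr0.
pose k := absz (L + B - n)%R.
have -> : n = L + B - k%:Z by lia.
rewrite /= !(lmul_coefE (K := k.+1) hL) // -coefD -mulrDr.
by apply: coefMr => j jk; rewrite coefD !coef_poly ltnS jk.
Qed.

Fact lone_neq0 : lone != 0.
Proof. by apply/eqP => /laurentP /(_ 0) /= /eqP; rewrite oner_eq0. Qed.

HB.instance Definition _ := GRing.Zmodule_isNzRing.Build (laurent A)
  lmulA lmul1 lmulr1 lmulDl lmulDr lone_neq0.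

Lemma lcoefM f g n : (f * g) n = \sum_(i \in [set: int]) f i * g (n - i).
Proof. exact: lmul_coef_unlock. Qed.

Lemma lcoef1 n : (1 : laurent A) n = (n == 0)%:R.
Proof. by rewrite /=; case: ifP. Qed.

Lemma lmonoM k a f n : (lmono k a * f) n = a * f (n - k).
Proof. exact: lmono_mul_coef. Qed.

Lemma lMmono k a f n : (f * lmono k a) n = f (n - k) * a.
Proof. exact: lmul_mono_coef. Qed.

End LaurentRing.

Section LaurentAlg.
Variables (F : comNzRingType) (A : algType F).
Implicit Types (c : F) (f g : laurent A).

Fact lscale_bnd c f : exists N : int, forall n, N < n -> c *: f n = 0.
Proof. by have [N fN] := lcoef_bnd f; exists N => n /fN->; rewrite scaler0. Qed.
Definition lscale c f := Laurent (lscale_bnd c f).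

Fact lscaleA a b f : lscale a (lscale b f) = lscale (a * b) f.
Proof. by apply/laurentP => n /=; rewrite scalerA. Qed.
Fact lscale1 : left_id 1 lscale.
Proof. by move=> f; apply/laurentP => n /=; rewrite scale1r. Qed.
Fact lscaleDr : right_distributive lscale +%R.
Proof. by move=> c f g; apply/laurentP => n /=; rewrite scalerDr. Qed.
Fact lscaleDl f : {morph lscale^~ f : a b / a + b}.
Proof. by move=> a b; apply/laurentP => n /=; rewrite scalerDl. Qed.
HB.instance Definition _ := GRing.Zmodule_isLmodule.Build F (laurent A)
  lscaleA lscale1 lscaleDr lscaleDl.

Lemma lcoefZ c f n : (c *: f) n = c *: f n. Proof. by []. Qed.

Let lscaleE c f : c *: f = lmono 0 c%:A * f.
Proof. by apply/laurentP => n; rewrite lmonoM mulr_algl subr0. Qed.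

Fact lscaleAl c f g : c *: (f * g) = (c *: f) * g.
Proof. by rewrite !lscaleE mulrA. Qed.
HB.instance Definition _ := GRing.Lmodule_isLalgebra.Build F (laurent A)
  lscaleAl.

Fact lscaleAr c f g : c *: (f * g) = f * (c *: g).
Proof.
have cf : lmono 0 c%:A * f = f * lmono 0 c%:A.
  by apply/laurentP => n; rewrite lmonoM lMmono mulr_algl mulr_algr.
by rewrite !lscaleE (mulrA f) -cf -(mulrA _ f g).
Qed.
HB.instance Definition _ := GRing.Lalgebra_isAlgebra.Build F (laurent A)
  lscaleAr.

End LaurentAlg.

Section LaurentSubst.
Variables (F : fieldType) (A : algType F).
Implicit Types f : laurent A.

Fact lsubst_bnd (c : F) f : exists N : int, forall n, N < n -> c ^ n *: f n = 0.
Proof. by have [N fN] := lcoef_bnd f; exists N => n /fN->; rewrite scaler0. Qed.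
(* f(c u) *)
Definition lsubst c f : laurent A := Laurent (lsubst_bnd c f).

(* laurent (laurent A) holds the series in two variables, u being the inner  *)
(* and v the outer one: the coefficient of u^m v^n in x is x n m.            *)
Definition in_u f : laurent (laurent A) := lmono 0 f.

Fact in_v_bnd f : exists N : int, forall n, N < n -> lmono 0 (f n) = 0.
Proof.
have [N fN] := lcoef_bnd f; exists N => n /fN->.
by apply/laurentP => m /=; rewrite if_same.
Qed.
Definition in_v f : laurent (laurent A) := Laurent (in_v_bnd f).

End LaurentSubst.

Section FreeAlgebra.
Variables (F : comNzRingType) (X : choiceType).

(* The monoid algebra of multinomials, with its operations locked because     *)
(* conversion tends to diverge on the transparent ones.                       *)
Local Notation M := {malg F[{fmonom X}]}.
Definition freealg : Type := M.
HB.instance Definition _ := Choice.on freealg.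

Fact freealg_key : unit. Proof. by []. Qed.
Definition freealg_opp : freealg -> freealg :=
  locked_with freealg_key (fun p : M => - p).
Definition freealg_add : freealg -> freealg -> freealg :=
  locked_with freealg_key (fun p r : M => p + r).
Definition freealg_mul : freealg -> freealg -> freealg :=
  locked_with freealg_key (fun p r : M => p * r).
Definition freealg_scale : F -> freealg -> freealg :=
  locked_with freealg_key (fun c (p : M) => c *: p).

Lemma freealg_oppE (p : M) : freealg_opp p = - p.
Proof. by rewrite /freealg_opp unlock. Qed.
Lemma freealg_addE (p r : M) : freealg_add p r = p + r.
Proof. by rewrite /freealg_add unlock. Qed.
Lemma freealg_mulE (p r : M) : freealg_mul p r = p * r.
Proof. by rewrite /freealg_mul unlock. Qed.
Lemma freealg_scaleE (c : F) (p : M) : freealg_scale c p = c *: p.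
Proof. by rewrite /freealg_scale unlock. Qed.
Let unlockE := (freealg_oppE, freealg_addE, freealg_mulE, freealg_scaleE).

Fact freealg_addA : associative freealg_add.
Proof. by move=> p r s; rewrite !unlockE addrA. Qed.
Fact freealg_addC : commutative freealg_add.
Proof. by move=> p r; rewrite !unlockE addrC. Qed.
Fact freealg_add0 : left_id (0 : M) freealg_add.
Proof. by move=> p; rewrite !unlockE add0r. Qed.
Fact freealg_addN : left_inverse (0 : M) freealg_opp freealg_add.
Proof. by move=> p; rewrite !unlockE addNr. Qed.
HB.instance Definition _ := GRing.isZmodule.Build freealg
  freealg_addA freealg_addC freealg_add0 freealg_addN.

Fact freealg_mulA : associative freealg_mul.
Proof. by move=> p r s; rewrite !unlockE; exact: mulrA. Qed.
Fact freealg_mul1 : left_id (1 : M) freealg_mul.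
Proof. by move=> p; rewrite !unlockE; exact: mul1r. Qed.
Fact freealg_mulr1 : right_id (1 : M) freealg_mul.
Proof. by move=> p; rewrite !unlockE; exact: mulr1. Qed.
Fact freealg_mulDl : left_distributive freealg_mul freealg_add.
Proof. by move=> p r s; rewrite !unlockE; exact: mulrDl. Qed.
Fact freealg_mulDr : right_distributive freealg_mul freealg_add.
Proof. by move=> p r s; rewrite !unlockE; exact: mulrDr. Qed.
Fact freealg_one_neq0 : (1 : M) != 0.
Proof. exact: oner_neq0. Qed.
HB.instance Definition _ := GRing.Zmodule_isNzRing.Build freealg
  freealg_mulA freealg_mul1 freealg_mulr1 freealg_mulDl freealg_mulDr
  freealg_one_neq0.

Fact freealg_scaleA a b p :
  freealg_scale a (freealg_scale b p) = freealg_scale (a * b) p.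
Proof. by rewrite !unlockE; exact: scalerA. Qed.
Fact freealg_scale1 : left_id 1 freealg_scale.
Proof. by move=> p; rewrite !unlockE; exact: scale1r. Qed.
Fact freealg_scaleDr : right_distributive freealg_scale freealg_add.
Proof. by move=> c p r; rewrite !unlockE; exact: scalerDr. Qed.
Fact freealg_scaleDl p a b :
  freealg_scale (a + b) p = freealg_add (freealg_scale a p) (freealg_scale b p).
Proof. by rewrite !unlockE; exact: scalerDl. Qed.
HB.instance Definition _ := GRing.Zmodule_isLmodule.Build F freealg
  freealg_scaleA freealg_scale1 freealg_scaleDr freealg_scaleDl.

Fact freealg_scaleAl (c : F) (p r : freealg) :
  freealg_scale c (freealg_mul p r) = freealg_mul (freealg_scale c p) r.
Proof. by rewrite !unlockE; exact: scalerAl. Qed.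
HB.instance Definition _ := GRing.Lmodule_isLalgebra.Build F freealg
  freealg_scaleAl.

Fact freealg_scaleAr (c : F) (p r : freealg) :
  freealg_scale c (freealg_mul p r) = freealg_mul p (freealg_scale c r).
Proof.
have CE (s : freealg) : freealg_scale c s = freealg_mul (malgC c) s.
  by rewrite !unlockE; exact/esym/mul_malgC.
have Cp : freealg_mul (malgC c) p = freealg_mul p (malgC c).
  rewrite !unlockE !malgM_def fgmulUg fgmulgU.
  by apply: eq_bigr => k _; rewrite mulrC mul1m mulm1.
rewrite !CE; move: (malgC c) Cp => C Cp.
by rewrite freealg_mulA Cp -freealg_mulA.
Qed.
HB.instance Definition _ := GRing.Lalgebra_isAlgebra.Build F freealg
  freealg_scaleAr.

(* The locked operations are those of {malg F[{fmonom X}]}.                   *)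
Lemma freealgN (p : freealg) : (- p : freealg) = (- (p : M) : M).
Proof. exact: freealg_oppE. Qed.
Lemma freealgD (p r : freealg) : (p + r : freealg) = ((p : M) + r : M).
Proof. exact: freealg_addE. Qed.
Lemma freealgM (p r : freealg) : (p * r : freealg) = ((p : M) * r : M).
Proof. exact: freealg_mulE. Qed.
Lemma freealgZ (c : F) (p : freealg) : (c *: p : freealg) = (c *: (p : M) : M).
Proof. exact: freealg_scaleE. Qed.

Lemma freealg_sum (I : Type) (s : seq I) (P : pred I) (E : I -> freealg) :
  (\sum_(i <- s | P i) E i : freealg) = (\sum_(i <- s | P i) (E i : M) : M).
Proof. by elim/big_rec2: _ => // i x y _ <-; rewrite freealgD. Qed.

Definition fgen (x : X) : freealg := mkmalgU (fmu x) 1.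

(* the algebra morphism out of the free algebra that sends fgen x to g x *)
Definition free_eval (A : algType F) (g : X -> A) (p : freealg) : A :=
  mmap (GRing.in_alg A) (fun m : {fmonom X} => \prod_(x <- (m : seq X)) g x) p.

(* rel l r stands for the relation l = r *)
Inductive ideal_gen (rel : freealg -> freealg -> Prop) : freealg -> Prop :=
| ideal_gen0 : ideal_gen rel 0
| ideal_genD p r : ideal_gen rel p -> ideal_gen rel r -> ideal_gen rel (p + r)
| ideal_gen_rel a b l r : rel l r -> ideal_gen rel (a * (l - r) * b).

Definition presented_by (A : algType F) (g : X -> A)
    (rel : freealg -> freealg -> Prop) : Prop :=
  (forall a : A, exists p, free_eval g p = a) /\
  (forall p, free_eval g p = 0 <-> ideal_gen rel p).

End FreeAlgebra.

(* In this order: y_{-k}, y_{k+1}, z_{k+1} and \tilde z_{k+1}. *)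
Inductive gen := gYm of nat | gYp of nat | gZ of nat | gZt of nat.

Definition gen_code (x : gen) : nat * nat :=
  match x with
  | gYm k => (0, k) | gYp k => (1, k) | gZ k => (2, k) | gZt k => (3, k)
  end%N.
Definition gen_decode (c : nat * nat) : gen :=
  match c with
  | (0, k) => gYm k | (1, k) => gYp k | (2, k) => gZ k | (_, k) => gZt k
  end%N.
Lemma gen_codeK : cancel gen_code gen_decode. Proof. by case. Qed.
HB.instance Definition _ := Countable.copy gen (can_type gen_codeK).

Section Definitions.
Variables (F : fieldType) (q : F).

Definition rhobar : F := q^-1 * (q ^+ 2 - q ^- 2) ^+ 2.

Definition comm (A : algType F) (x y : A) : A := x * y - y * x.
Definition qcomm (A : algType F) (x y : A) : A :=
  q *: (x * y) - q^-1 *: (y * x).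

Local Notation Fr := (freealg F gen).
Local Notation ym k := (fgen F (gYm k)).
Local Notation yp k := (fgen F (gYp k)).
Local Notation z k := (fgen F (gZ k)).
Local Notation zt k := (fgen F (gZt k)).

(* z_k and \tilde z_k, with the convention for k = 0 *)
Definition z0 k : Fr := if k is k'.+1 then z k' else (rhobar / (q - q^-1))%:A.
Definition zt0 k : Fr := if k is k'.+1 then zt k' else (rhobar / (q - q^-1))%:A.

Inductive UqT_rel : Fr -> Fr -> Prop :=
| UqT_y1_ym k :
    UqT_rel (comm (yp 0) (ym k)) ((q + q^-1)^-1 *: (z k - zt k))
| UqT_yp_y0 k :
    UqT_rel (comm (yp k) (ym 0)) ((q + q^-1)^-1 *: (z k - zt k))
| UqT_y1_zt k : UqT_rel (qcomm (yp 0) (zt k)) (rhobar *: yp k.+1)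
| UqT_z_y1 k : UqT_rel (qcomm (z k) (yp 0)) (rhobar *: yp k.+1)
| UqT_zt_y0 k : UqT_rel (qcomm (zt k) (ym 0)) (rhobar *: ym k.+1)
| UqT_y0_z k : UqT_rel (qcomm (ym 0) (z k)) (rhobar *: ym k.+1)
| UqT_yp_yp k l : UqT_rel (comm (yp k) (yp l)) 0
| UqT_ym_ym k l : UqT_rel (comm (ym k) (ym l)) 0
| UqT_yp_ym k l : UqT_rel (comm (yp k) (ym l) + comm (ym k) (yp l)) 0
| UqT_yp_zt k l : UqT_rel (comm (yp k) (zt l) + comm (zt k) (yp l)) 0
| UqT_yp_z k l : UqT_rel (comm (yp k) (z l) + comm (z k) (yp l)) 0
| UqT_ym_zt k l : UqT_rel (comm (ym k) (zt l) + comm (zt k) (ym l)) 0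
| UqT_ym_z k l : UqT_rel (comm (ym k) (z l) + comm (z k) (ym l)) 0
| UqT_zt_zt k l : UqT_rel (comm (zt k) (zt l)) 0
| UqT_z_z k l : UqT_rel (comm (z k) (z l)) 0
| UqT_z_zt k l : UqT_rel (comm (z k) (zt l) + comm (zt k) (z l)) 0
| UqT_det n :
    UqT_rel
      ((rhobar * (q + q^-1)) *:
         (\sum_(0 <= k < n.+1) q ^ (2 * k%:Z - n%:Z) *: (yp k * ym (n - k)))
       - \sum_(0 <= k < n.+2)
           q ^ (2 * k%:Z - n%:Z - 1) *: (z0 k * zt0 (n.+1 - k)))
      0.

Definition UqT_ideal : {pred Fr} := fun p => `[< ideal_gen UqT_rel p >].

Lemma UqT_idealP p : reflect (ideal_gen UqT_rel p) (p \in UqT_ideal).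
Proof. exact: asboolP. Qed.

Lemma UqT_idealM a b p : p \in UqT_ideal -> a * p * b \in UqT_ideal.
Proof.
move/UqT_idealP => Ip; apply/UqT_idealP; elim: Ip => [|p1 p2 _ I1 _ I2|c d l r lr].
- by rewrite mulr0 mul0r; exact: ideal_gen0.
- by rewrite mulrDr mulrDl; exact: ideal_genD.
- have -> : a * (c * (l - r) * d) * b = (a * c) * (l - r) * (d * b).
    by move: (l - r) => e; rewrite !mulrA.
  exact: ideal_gen_rel.
Qed.

Fact UqT_ideal_zmod_closed : zmod_closed UqT_ideal.
Proof.
split=> [|p r Ip Ir]; first by apply/UqT_idealP; exact: ideal_gen0.
have Nr : - r \in UqT_ideal by rewrite -mulN1r -[_ * _]mulr1 UqT_idealM.
by apply/UqT_idealP/ideal_genD; exact/UqT_idealP.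
Qed.
HB.instance Definition _ := GRing.isZmodClosed.Build Fr UqT_ideal
  UqT_ideal_zmod_closed.

Lemma aug_exists : exists aug : Fr -> F,
  [/\ {morph aug : p r / p + r}, {morph aug : p r / p * r},
      forall c, {morph aug : p / c *: p >-> c * p},
      forall x, aug (fgen F x) = 0 & aug 1 = 1].
Proof.
exists (mcoeff (mone : {fmonom gen})); split.
- by move=> p r; rewrite freealgD; exact: mcoeffD.
- move=> p r; rewrite freealgM.
  exact: (rmorphM (mcoeff (mone : {fmonom gen}))).
- by move=> c p; rewrite freealgZ; exact: mcoeffZ.
- by move=> x; rewrite /fgen mcoeffU /= (_ : (_ == _) = false) // fmP fmU fm1.
- exact: (rmorph1 (mcoeff (mone : {fmonom gen}))).
Qed.

Section Augmentation.
Variable aug : Fr -> F.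
Hypotheses (augD : {morph aug : p r / p + r})
  (augM : {morph aug : p r / p * r})
  (augZ : forall c, {morph aug : p / c *: p >-> c * p})
  (aug_fgen : forall x, aug (fgen F x) = 0).

Let aug0 : aug 0 = 0.
Proof. by rewrite -(scale0r 0) augZ mul0r. Qed.
Let augB p r : aug (p - r) = aug p - aug r.
Proof. by rewrite augD -scaleN1r augZ mulN1r. Qed.
Let aug_comm p r : aug (comm p r) = 0.
Proof. by rewrite augB !augM mulrC subrr. Qed.
Let aug_comm2 p r p' r' : aug (comm p r + comm p' r') = 0.
Proof. by rewrite augD !aug_comm addr0. Qed.
Let aug_qcomm x y : aug (qcomm (fgen F x) (fgen F y)) = 0.
Proof.
rewrite /qcomm; move: (fgen F x) (fgen F y) (aug_fgen x) => a b a0.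
by rewrite augB (augZ q) (augZ q^-1) (augM a) (augM b) a0 mul0r !mulr0 subr0.
Qed.
Let aug_z x y c : aug (c *: (fgen F x - fgen F y)) = 0.
Proof. by rewrite augZ augB (aug_fgen x) (aug_fgen y) subr0 mulr0. Qed.
Let aug_y x c : aug (c *: fgen F x) = 0.
Proof. by rewrite augZ aug_fgen mulr0. Qed.

Lemma aug_rel l r : UqT_rel l r -> aug l = aug r.
Proof.
case=> [k|k|k|k|k|k|k j|k j|k j|k j|k j|k j|k j|k j|k j|k j|n];
  rewrite ?aug0 ?aug_comm2 ?aug_comm ?aug_qcomm ?aug_z ?aug_y //.
rewrite augB augZ !(big_morph aug augD aug0) !big1 ?mulr0 ?subr0 //.
  by case=> [|k] _; rewrite augZ augM /= aug_fgen !(mul0r, mulr0).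
by move=> k _; rewrite augZ augM aug_fgen mul0r mulr0.
Qed.

Lemma aug_ideal p : ideal_gen UqT_rel p -> aug p = 0.
Proof.
elim=> [//|p1 p2 _ I1 _ I2|a b l r /aug_rel lr]; first by rewrite augD I1 I2 addr0.
by rewrite !augM augB lr subrr mulr0 mul0r.
Qed.

End Augmentation.

Lemma UqT_ideal1 : 1 \notin UqT_ideal.
Proof.
have [aug [augD augM augZ aug_fgen aug1]] := aug_exists.
apply/negP => /UqT_idealP/(aug_ideal augD augM augZ aug_fgen)/eqP.
by rewrite aug1 oner_eq0.
Qed.

Definition UqT : Type := Quotient.quot UqT_ideal.
HB.instance Definition _ := GRing.Zmodule.on UqT.
HB.instance Definition _ := Quotient.on UqT.

Local Notation pi := (\pi_UqT)%qT.

Lemma UqT_piP p r : reflect (pi p = pi r) (p - r \in UqT_ideal).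
Proof. by rewrite Quotient.idealrBE; exact: eqP. Qed.

Definition UqT_one : UqT := pi 1.
Definition UqT_mul (x y : UqT) : UqT := pi (repr x * repr y).
Definition UqT_scale (c : F) (x : UqT) : UqT := pi (c *: repr x).

Let UqT_pi_ind (P : UqT -> Prop) : (forall p, P (pi p)) -> forall x, P x.
Proof. by move=> Ppi x; rewrite -[x]reprK; exact: Ppi. Qed.

Let pi_repr p : repr (pi p) - p \in UqT_ideal.
Proof. by apply/UqT_piP; rewrite reprK. Qed.

Lemma UqT_piB : {morph pi : p r / p - r}. Proof. exact: raddfB. Qed.
Lemma UqT_piD : {morph pi : p r / p + r}. Proof. exact: raddfD. Qed.

Lemma UqT_piM : {morph pi : p r / p * r >-> UqT_mul p r}.
Proof.
move=> p r; apply/esym/UqT_piP.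
have -> : repr (pi p) * repr (pi r) - p * r =
    1 * (repr (pi p) - p) * repr (pi r) + p * (repr (pi r) - r) * 1.
  by rewrite mul1r mulr1 mulrBl mulrBr addrA subrK.
by rewrite rpredD ?UqT_idealM ?pi_repr.
Qed.

Lemma UqT_piZ c : {morph pi : p / c *: p >-> UqT_scale c p}.
Proof.
move=> p; apply/esym/UqT_piP; rewrite -scalerBr -mulr_algl -[_ * _]mulr1.
by rewrite UqT_idealM ?pi_repr.
Qed.

Fact UqT_mulA : associative UqT_mul.
Proof.
elim/UqT_pi_ind=> x; elim/UqT_pi_ind=> y; elim/UqT_pi_ind=> z.
by rewrite -!UqT_piM mulrA.
Qed.
Fact UqT_mul1 : left_id UqT_one UqT_mul.
Proof. by elim/UqT_pi_ind=> x; rewrite -UqT_piM mul1r. Qed.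
Fact UqT_mulr1 : right_id UqT_one UqT_mul.
Proof. by elim/UqT_pi_ind=> x; rewrite -UqT_piM mulr1. Qed.
Fact UqT_mulDl : left_distributive UqT_mul +%R.
Proof.
elim/UqT_pi_ind=> x; elim/UqT_pi_ind=> y; elim/UqT_pi_ind=> z.
by rewrite -UqT_piD -!UqT_piM mulrDl UqT_piD.
Qed.
Fact UqT_mulDr : right_distributive UqT_mul +%R.
Proof.
elim/UqT_pi_ind=> x; elim/UqT_pi_ind=> y; elim/UqT_pi_ind=> z.
by rewrite -UqT_piD -!UqT_piM mulrDr UqT_piD.
Qed.
Fact UqT_one_neq0 : UqT_one != 0.
Proof.
apply/eqP => one0; case/negP: UqT_ideal1; rewrite -[1]subr0.
by apply/UqT_piP; rewrite raddf0.
Qed.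
HB.instance Definition _ := GRing.Zmodule_isNzRing.Build UqT
  UqT_mulA UqT_mul1 UqT_mulr1 UqT_mulDl UqT_mulDr UqT_one_neq0.

Fact UqT_scaleA a b x : UqT_scale a (UqT_scale b x) = UqT_scale (a * b) x.
Proof. by elim/UqT_pi_ind: x => x; rewrite -!UqT_piZ scalerA. Qed.
Fact UqT_scale1 : left_id 1 UqT_scale.
Proof. by elim/UqT_pi_ind=> x; rewrite -UqT_piZ scale1r. Qed.
Fact UqT_scaleDr : right_distributive UqT_scale +%R.
Proof.
move=> c; elim/UqT_pi_ind=> x; elim/UqT_pi_ind=> y.
by rewrite -UqT_piD -!UqT_piZ scalerDr UqT_piD.
Qed.
Fact UqT_scaleDl x : {morph UqT_scale^~ x : a b / a + b}.
Proof.
by elim/UqT_pi_ind: x => x a b; rewrite -!UqT_piZ scalerDl UqT_piD.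
Qed.
HB.instance Definition _ := GRing.Zmodule_isLmodule.Build F UqT
  UqT_scaleA UqT_scale1 UqT_scaleDr UqT_scaleDl.

Fact UqT_scaleAl c (x y : UqT) : c *: (x * y) = (c *: x) * y.
Proof.
elim/UqT_pi_ind: x => x; elim/UqT_pi_ind: y => y.
by rewrite /*:%R /= -[_ * _]UqT_piM -!UqT_piZ scalerAl UqT_piM.
Qed.
HB.instance Definition _ := GRing.Lmodule_isLalgebra.Build F UqT UqT_scaleAl.

Fact UqT_scaleAr c (x y : UqT) : c *: (x * y) = x * (c *: y).
Proof.
elim/UqT_pi_ind: x => x; elim/UqT_pi_ind: y => y.
by rewrite /*:%R /= -[_ * _]UqT_piM -!UqT_piZ scalerAr UqT_piM.
Qed.
HB.instance Definition _ := GRing.Lalgebra_isAlgebra.Build F UqT UqT_scaleAr.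

Definition UqT_gen (x : gen) : UqT := pi (fgen F x).

Lemma UqT_evalE p : free_eval UqT_gen p = pi p.
Proof.
rewrite [in RHS](monalgE p) -freealg_sum raddf_sum; apply: eq_bigr => /= m _.
have -> : mkmalgU m p@_m = p@_m *: (mkmalgU m 1 : Fr) :> Fr.
  by rewrite freealgZ; apply/malgP => k; rewrite mcoeffZ !mcoeffU mulrnAr mulr1.
rewrite UqT_piZ mulr_algl; congr (_ *: _).
case: m => s; elim: s => [|x s IHs] /=.
  by rewrite big_nil; congr (pi _); rewrite -fmoneE.
rewrite big_cons IHs /UqT_gen -[_ * _]UqT_piM; congr (pi _).
rewrite freealgM malgM_def fgmulUU mulr1.
by rewrite fmuE /mul /= fmmulE.
Qed.

Lemma UqT_presented : presented_by UqT_gen UqT_rel.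
Proof.
split=> [a|p]; first by exists (repr a); rewrite UqT_evalE reprK.
rewrite UqT_evalE; split=> [p0|/UqT_idealP Ip].
  by apply/UqT_idealP; rewrite -[p]subr0; apply/UqT_piP; rewrite raddf0.
by rewrite -(raddf0 pi); apply/UqT_piP; rewrite subr0.
Qed.

Section FreidelMaillet.
Variables kp km : F.

Section Matrices.
Variable B : algType F.

Definition mx4 (s : seq (seq B)) : 'M[B]_(2 * 2) :=
  \matrix_(i, j) nth 0 (nth [::] s i) j.

(* R(w), with wV standing for w^-1; the basis is ordered as in tensmx *)
Definition Rmx (w wV : B) : 'M[B]_(2 * 2) :=
  let a := q *: w - q^-1 *: wV in
  let b := w - wV in
  let c := (q - q^-1)%:A in
  mx4 [:: [:: a; 0; 0; 0];
          [:: 0; b; c; 0];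
          [:: 0; c; b; 0];
          [:: 0; 0; 0; a]].

Definition R0mx : 'M[B]_(2 * 2) :=
  mx4 [:: [:: 1; 0; 0; 0];
          [:: 0; q^-1%:A; 0; 0];
          [:: 0; 0; q^-1%:A; 0];
          [:: 0; 0; 0; 1]].

Definition Pmx : 'M[B]_(2 * 2) := (q - q^-1)^-1%:A *: Rmx 1 1.
Definition Pminus : 'M[B]_(2 * 2) := 2^-1%:A *: (1%:M - Pmx).

End Matrices.

Variables (A : algType F) (g : gen -> A).

(* The coefficient of u^n in \sum_k y_k U^(-k-1), where U = q u^2 / (q + q^-1) *)
(* and hence U^(-k-1) = ((q + q^-1) / q)^(k+1) u^(-2(k+1)). Recall that        *)
(* Negz m is -(m+1).                                                           *)
Definition genfun_coef (y : nat -> A) (n : int) : A :=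
  match n with
  | Posz _ => 0
  | Negz m => if odd m then ((q + q^-1) / q) ^+ m./2.+1 *: y m./2 else 0
  end.

Fact genfun_bnd (y : nat -> A) :
  exists N : int, forall n, N < n -> genfun_coef y n = 0.
Proof. by exists 0; case. Qed.
Definition genfun (y : nat -> A) : laurent A := Laurent (genfun_bnd y).

Lemma genfunE y k :
  genfun y (- (2 * k.+1)%:Z) = ((q + q^-1) / q) ^+ k.+1 *: y k.
Proof. by rewrite mul2n doubleS -NegzE /= odd_double /= uphalf_double. Qed.

Definition Yp : laurent A := genfun (fun k => g (gYp k)).
Definition Ym : laurent A := genfun (fun k => g (gYm k)).
Definition Zp : laurent A := genfun (fun k => g (gZt k)).
Definition Zm : laurent A := genfun (fun k => g (gZ k)).

Definition Kmx : 'M[laurent A]_2 :=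
  let u := lmono 1 1 : laurent A in
  let K12 := (km * (q + q^-1))^-1 *: Zp + (kp * (q + q^-1) / (q - q^-1))%:A in
  let K21 := (kp * (q + q^-1))^-1 *: Zm + (km * (q + q^-1) / (q - q^-1))%:A in
  \matrix_(i < 2, j < 2)
    nth 0 (nth [::] [:: [:: q *: u * Yp; K12]; [:: K21; q *: u * Ym]] i) j.

Local Notation L2 := (laurent (laurent A)).
Let u_v : L2 := lmono (-1) (lmono 1 1).
Let v_u : L2 := lmono 1 (lmono (-1) 1).
Let Ku : 'M[L2]_2 := map_mx (@in_u F A) Kmx.
Let Kv : 'M[L2]_2 := map_mx (@in_v F A) Kmx.

Definition FM_lhs : 'M[L2]_(2 * 2) :=
  Rmx u_v v_u *m (Ku *t 1%:M) *m R0mx L2 *m (1%:M *t Kv).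
Definition FM_rhs : 'M[L2]_(2 * 2) :=
  (1%:M *t Kv) *m R0mx L2 *m (Ku *t 1%:M) *m Rmx u_v v_u.

Definition FM_qdet : laurent A :=
  \tr (Pminus (laurent A) *m ((Kmx *t 1%:M) *m R0mx (laurent A)
         *m (1%:M *t map_mx (lsubst q) Kmx))).

End FreidelMaillet.

Inductive FM_rel (kp km : F) : Fr -> Fr -> Prop :=
| FM_RKRK i j (m n : int) :
    FM_rel kp km (FM_lhs kp km (@fgen F gen) i j n m)
                 (FM_rhs kp km (@fgen F gen) i j n m)
| FM_trace (n : int) :
    FM_rel kp km
      (FM_qdet kp km (@fgen F gen) n)
      (((- (rhobar / (q - q^-1) ^+ 2))%:A : laurent Fr) n).

End Definitions.

Section BaseField.
Variable R : realType.

Definition Cq : fieldType := {fraction {poly R[i]}}.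
Definition qvar : Cq := tofrac 'X.

End BaseField.

(* Main.v *)
Require Import Defs.
From mathcomp Require Import all_boot all_order all_algebra.
From mathcomp Require Import reals.
From mathcomp Require Import boolp classical_sets fsbigop.
From mathcomp Require Import mxtens complex ring zify.

(* The two presentations have the same generators, so the theorem compares    *)
(* two ideals of the free algebra, one coefficient of u^m v^n at a time.      *)
(* Put T = 1 / U(u) and S = 1 / U(v). The entries of the RKRK equation say    *)
(* that the coefficients of each of the four series commute, that the         *)
(* commutators [x_k, y_(l+1)] and the q-commutators of x_k and y_l are        *)
(* symmetric in k and l for each diagonal series x and each off-diagonal      *)
(* series y, and, in the diagonal-diagonal and antidiagonal-antidiagonal      *)
(* case, two cross relations with a factor S - T.                             *)
(*   The defining relations of U_q^{T,+} are linear combinations of these.    *)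
(* Conversely, symmetry of the q-commutators holds because rho x_k is the     *)
(* q-commutator of x_0 with y_k while the y_k commute, and the cross          *)
(* relations come out of the Leibniz rule applied to the commutators of       *)
(* [y_1, zt_(k+1)]_q with y_(-l) and of zt_k with [y_1, y_(-l)].              *)
(*   The quantum trace is a multiple of the sum of the determinant relation   *)
(* and of its image under y_(-k) <-> y_(k+1), z <-> zt; the cross relations   *)
(* at S = q^-2 T show that these two differ by an element of the ideal.       *)

Set Implicit Arguments.
Unset Strict Implicit.
Unset Printing Implicit Defensive.

Import Order.TTheory GRing.Theory Num.Theory.

Local Open Scope ring_scope.

(** * Noncommutative polynomial identities *)

Section NoncommutativeNormalForm.
Variables (F : comNzRingType) (A : algType F).

Inductive ncexp :=
| NcVar of nat | Nc0 | Nc1 | NcOpp of ncexp | NcScale of F & ncexp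
| NcAdd of ncexp & ncexp | NcMul of ncexp & ncexp.

Fixpoint nc_eval (env : seq A) (e : ncexp) : A :=
  match e with
  | NcVar n => nth 0 env n
  | Nc0 => 0
  | Nc1 => 1
  | NcOpp a => - nc_eval env a
  | NcScale c a => c *: nc_eval env a
  | NcAdd a b => nc_eval env a + nc_eval env b
  | NcMul a b => nc_eval env a * nc_eval env b
  end.

Definition ncterm : Type := F * seq nat.

Fixpoint nc_mulr (x : ncterm) (s : seq ncterm) : seq ncterm :=
  if s is y :: s' then (x.1 * y.1, x.2 ++ y.2) :: nc_mulr x s' else [::].

Fixpoint nc_mul (r s : seq ncterm) : seq ncterm :=
  if r is x :: r' then nc_mulr x s ++ nc_mul r' s else [::].

Fixpoint nc_scale (c : F) (s : seq ncterm) : seq ncterm :=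
  if s is x :: s' then (c * x.1, x.2) :: nc_scale c s' else [::].

Fixpoint nc_terms (e : ncexp) : seq ncterm :=
  match e with
  | NcVar n => [:: (1, [:: n])]
  | Nc0 => [::]
  | Nc1 => [:: (1, [::])]
  | NcOpp a => nc_scale (-1) (nc_terms a)
  | NcScale c a => nc_scale c (nc_terms a)
  | NcAdd a b => nc_terms a ++ nc_terms b
  | NcMul a b => nc_mul (nc_terms a) (nc_terms b)
  end.

(* Plain fixpoints instead of the overloaded == on seq nat, so that           *)
(* normalization can be restricted to a short list of constants.              *)
Fixpoint nat_same (m n : nat) : bool :=
  match m, n with
  | 0%N, 0%N => true | m'.+1, n'.+1 => nat_same m' n' | _, _ => false
  end.
Fixpoint word_same (v w : seq nat) : bool :=
  match v, w with
  | [::], [::] => true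
  | m :: v', n :: w' => if nat_same m n then word_same v' w' else false
  | _, _ => false
  end.

Fixpoint nc_insert (x : ncterm) (s : seq ncterm) : seq ncterm :=
  if s is y :: s' then
    if word_same x.2 y.2 then (x.1 + y.1, y.2) :: s' else y :: nc_insert x s'
  else [:: x].

Fixpoint nc_collect (s : seq ncterm) : seq ncterm :=
  if s is x :: s' then nc_insert x (nc_collect s') else [::].

Fixpoint nc_null (s : seq ncterm) : Prop :=
  if s is x :: s' then x.1 = 0 /\ nc_null s' else True.

Definition nc_word (env : seq A) (w : seq nat) : A := \prod_(i <- w) env`_i.
Definition nc_sum (env : seq A) (s : seq ncterm) : A :=
  \sum_(x <- s) x.1 *: nc_word env x.2.

Lemma nat_sameP m n : nat_same m n -> m = n.
Proof. by elim: m n => [|m IHm] [|n] //= /IHm->. Qed.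

Lemma word_sameP v w : word_same v w -> v = w.
Proof.
elim: v w => [|m v IHv] [|n w] //=.
by case: ifP => // /nat_sameP -> /IHv->.
Qed.

Lemma nc_sum_mulr env x s :
  nc_sum env (nc_mulr x s) = x.1 *: nc_word env x.2 * nc_sum env s.
Proof.
rewrite /nc_sum; elim: s => [|y s IHs] /=; first by rewrite !big_nil mulr0.
rewrite !big_cons IHs mulrDr; congr (_ + _).
by rewrite /nc_word big_cat -scalerAl -scalerAr scalerA.
Qed.

Lemma nc_sum_mul env r s :
  nc_sum env (nc_mul r s) = nc_sum env r * nc_sum env s.
Proof.
elim: r => [|x r IHr] /=; first by rewrite /nc_sum big_nil mul0r.
rewrite [LHS]/nc_sum big_cat /= -!/(nc_sum _ _) nc_sum_mulr IHr -mulrDl.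
by rewrite [nc_sum env (x :: r)]/nc_sum big_cons.
Qed.

Lemma nc_sum_scale env c s : nc_sum env (nc_scale c s) = c *: nc_sum env s.
Proof.
rewrite /nc_sum; elim: s => [|x s IHs] /=; first by rewrite !big_nil scaler0.
by rewrite !big_cons IHs scalerDr scalerA.
Qed.

Lemma nc_sum_terms env e : nc_sum env (nc_terms e) = nc_eval env e.
Proof.
elim: e => //= [n|||a IHa|c a IHa|a IHa b IHb|a IHa b IHb].
- by rewrite /nc_sum big_seq1 /nc_word big_seq1 scale1r.
- by rewrite /nc_sum big_nil.
- by rewrite /nc_sum big_seq1 /nc_word big_nil scale1r.
- by rewrite nc_sum_scale IHa scaleN1r.
- by rewrite nc_sum_scale IHa.
- by rewrite -IHa -IHb /nc_sum big_cat.
- by rewrite nc_sum_mul IHa IHb.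
Qed.

Lemma nc_sum_insert env x s :
  nc_sum env (nc_insert x s) = x.1 *: nc_word env x.2 + nc_sum env s.
Proof.
rewrite /nc_sum; elim: s => [|y s IHs] /=.
  by rewrite big_seq1 big_nil addr0.
case: ifP => [/word_sameP xy|_]; rewrite !big_cons.
  by rewrite xy scalerDl addrA.
by rewrite IHs addrCA.
Qed.

Lemma nc_sum_collect env s : nc_sum env (nc_collect s) = nc_sum env s.
Proof.
elim: s => //= x s IHs.
by rewrite nc_sum_insert IHs /nc_sum big_cons.
Qed.

Lemma nc_sum_null env s : nc_null s -> nc_sum env s = 0.
Proof.
rewrite /nc_sum; elim: s => [|x s IHs] /=; first by rewrite big_nil.
by case=> x0 /IHs s0; rewrite big_cons s0 x0 scale0r addr0.
Qed.

Lemma nc_eq env a b :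
    nc_null (nc_collect (nc_terms (NcAdd a (NcOpp b)))) ->
  nc_eval env a = nc_eval env b.
Proof.
move=> /(nc_sum_null env); rewrite nc_sum_collect nc_sum_terms /=.
by move/eqP; rewrite subr_eq0 => /eqP.
Qed.

End NoncommutativeNormalForm.

Ltac nc_addvar x l :=
  match l with
  | context [x :: _] => l
  | _ => constr:(x :: l)
  end.
Ltac nc_vars t l :=
  lazymatch t with
  | @GRing.add _ ?a ?b => let l' := nc_vars a l in nc_vars b l'
  | @GRing.mul _ ?a ?b => let l' := nc_vars a l in nc_vars b l'
  | @GRing.opp _ ?a => nc_vars a l
  | @GRing.scale _ _ _ ?a => nc_vars a l
  | @GRing.zero _ => l
  | @GRing.one _ => l
  | _ => nc_addvar t l
  end.
Ltac nc_index x l :=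
  lazymatch l with
  | x :: _ => constr:(0%N)
  | _ :: ?l' => let n := nc_index x l' in constr:(S n)
  end.
Ltac nc_reify F t l :=
  lazymatch t with
  | @GRing.add _ ?a ?b =>
    let a' := nc_reify F a l in let b' := nc_reify F b l in
    constr:(@NcAdd F a' b')
  | @GRing.mul _ ?a ?b =>
    let a' := nc_reify F a l in let b' := nc_reify F b l in
    constr:(@NcMul F a' b')
  | @GRing.opp _ ?a => let a' := nc_reify F a l in constr:(@NcOpp F a')
  | @GRing.scale _ _ ?c ?a =>
    let a' := nc_reify F a l in constr:(@NcScale F c a')
  | @GRing.zero _ => constr:(@Nc0 F)
  | @GRing.one _ => constr:(@Nc1 F)
  | _ => let n := nc_index t l in constr:(@NcVar F n)
  end.
(* Reduces an identity between noncommutative polynomials to the identities   *)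
(* between the coefficients of each word.                                     *)
Ltac nc_ring A :=
  lazymatch type of A with
  | @GRing.Algebra.type ?F =>
    lazymatch goal with
    | |- ?a = ?b =>
      let l := nc_vars a (@nil A) in
      let l := nc_vars b l in
      let a' := nc_reify F a l in
      let b' := nc_reify F b l in
      apply: (@nc_eq F A l a' b');
      lazy [nc_null nc_collect nc_insert nc_terms nc_mul nc_mulr nc_scale
            word_same nat_same cat fst snd];
      repeat match goal with |- _ /\ _ => split | |- True => constructor end
    end
  end.

(** * Relations modulo a two-sided ideal *)

Definition two_sided_ideal (A : nzRingType) (I : A -> Prop) : Prop :=
  [/\ I 0, forall x y, I x -> I y -> I (x + y)
    & forall a x b, I x -> I (a * x * b)].

Section IdealClosure.
Variables (F : fieldType) (A : algType F) (I : A -> Prop).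
Hypothesis idI : two_sided_ideal I.

Lemma ideal_eq x y : I x -> y = x -> I y. Proof. by move=> Ix ->. Qed.
Lemma ideal_zero x : x = 0 -> I x. Proof. by move->; case: idI. Qed.
Lemma idealD x y : I x -> I y -> I (x + y).
Proof. by case: idI => _ iD _; exact: iD. Qed.
Lemma idealMl a x : I x -> I (a * x).
Proof. by case: idI => _ _ iM Ix; rewrite -[a * x]mulr1; exact: iM. Qed.
Lemma idealMr b x : I x -> I (x * b).
Proof. by case: idI => _ _ iM Ix; rewrite -[x]mul1r; exact: iM. Qed.
Lemma idealZ c x : I x -> I (c *: x).
Proof. by move=> Ix; rewrite -mulr_algl; exact: idealMl. Qed.
Lemma idealN x : I x -> I (- x).
Proof. by move=> Ix; rewrite -scaleN1r; exact: idealZ. Qed.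
Lemma idealB x y : I x -> I y -> I (x - y).
Proof. by move=> Ix /idealN; exact: idealD. Qed.
Lemma idealZE c x : c != 0 -> I (c *: x) -> I x.
Proof. by move=> c0 /(@idealZ c^-1); rewrite scalerA mulVf // scale1r. Qed.
Lemma ideal_commr w x : I x -> I (comm x w).
Proof. by move=> Ix; apply: idealB; [exact: idealMr | exact: idealMl]. Qed.
Lemma ideal_commutl w x : I x -> I (comm w x).
Proof. by move=> Ix; apply: idealB; [exact: idealMl | exact: idealMr]. Qed.
Lemma ideal_qcommr q w x : I x -> I (qcomm q x w).
Proof.
by move=> Ix; apply: idealB; apply: idealZ; [exact: idealMr | exact: idealMl].
Qed.
Lemma ideal_qcommutl q w x : I x -> I (qcomm q w x).
Proof.
by move=> Ix; apply: idealB; apply: idealZ; [exact: idealMl | exact: idealMr].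
Qed.
Lemma ideal_sum (J : Type) (r : seq J) (P : pred J) (E : J -> A) :
  (forall i, P i -> I (E i)) -> I (\sum_(i <- r | P i) E i).
Proof.
move=> IE; elim/big_rec: _ => [|i x Pi Ix]; first exact: ideal_zero.
by apply: idealD => //; exact: IE.
Qed.

End IdealClosure.

Section IntegerIndices.
Variable A : zmodType.

(* Extension of a sequence by zero to the negative indices, so that the       *)
(* coefficients of a product of series need no case distinction.              *)
Definition zext (x : nat -> A) (i : int) : A := if i is Posz k then x k else 0.

Lemma zext_pred x k : zext x (k.+1%:Z - 1) = x k.
Proof. by have -> : k.+1%:Z - 1 = k%:Z by lia. Qed.

Lemma zext_0pred x : zext x (0%N%:Z - 1) = 0. Proof. by []. Qed.
Lemma zext_npred x k : zext x (Negz k - 1) = 0.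
Proof. by have -> : Negz k - 1 = Negz k.+1 by lia. Qed.
Lemma zext_nat x (k : nat) : zext x k = x k. Proof. by []. Qed.
Lemma zext_neg x k : zext x (Negz k) = 0. Proof. by []. Qed.
Definition zextE :=
  (zext_pred, zext_0pred, zext_npred, zext_nat, zext_neg).

End IntegerIndices.

Section CoefficientRelations.
Variables (F : fieldType) (q : F) (A : algType F) (I : A -> Prop).
Hypotheses (q0 : q != 0) (q1 : q ^+ 2 - 1 != 0) (q2 : q ^+ 2 + 1 != 0).
Hypothesis idI : two_sided_ideal I.

Local Notation rho := (rhobar q).
Local Notation D := (idealD idI).
Local Notation B := (idealB idI).
Local Notation N := (idealN idI).
Local Notation Z := (idealZ idI).
Local Notation ML := (idealMl idI).
Local Notation MR := (idealMr idI).

Lemma rhobar_neq0 : rho != 0.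
Proof.
have -> : rho = ((q ^+ 2 - 1) * (q ^+ 2 + 1)) ^+ 2 / q ^+ 5.
  by rewrite /rhobar; field.
by rewrite mulf_neq0 ?invr_eq0 ?expf_neq0 ?mulf_neq0.
Qed.
Let rho0 := rhobar_neq0.

Lemma qp_neq0 : q + q^-1 != 0.
Proof.
by have -> : q + q^-1 = (q ^+ 2 + 1) / q; [field | rewrite mulf_neq0 ?invr_eq0].
Qed.

Lemma qm_neq0 : q - q^-1 != 0.
Proof.
by have -> : q - q^-1 = (q ^+ 2 - 1) / q; [field | rewrite mulf_neq0 ?invr_eq0].
Qed.

(* Mutually opposite relations are treated at once: [omul true] is the        *)
(* opposite multiplication.                                                   *)
Definition omul (o : bool) (x y : A) : A := if o then y * x else x * y.
Definition ocomm o x y := omul o x y - omul o y x.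
Definition oqcomm o x y := q *: omul o x y - q^-1 *: omul o y x.

Definition self_rel (x : nat -> A) (i j : int) : A :=
  q *: comm (zext x i) (zext x (j - 1))
  - q^-1 *: comm (zext x (i - 1)) (zext x j).

Definition mixed_rel1 o (x y : nat -> A) (i j : int) : A :=
  q *: omul o (zext x i) (zext y (j - 1))
  - q^-1 *: omul o (zext x (i - 1)) (zext y j)
  - q^-1 *: (omul o (zext y (j - 1)) (zext x i)
             - omul o (zext y j) (zext x (i - 1)))
  - (q - q^-1) *: omul o (zext x (j - 1)) (zext y i).

Definition mixed_rel2 o (x y : nat -> A) (i j : int) : A :=
  omul o (zext y i) (zext x (j - 1))
  - q ^- 2 *: omul o (zext y (i - 1)) (zext x j)
  - (1 - q ^- 2) *: omul o (zext y j) (zext x (i - 1))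
  - (omul o (zext x (j - 1)) (zext y i) - omul o (zext x j) (zext y (i - 1))).

Definition cross_rel1 (p m z t : nat -> A) (i j : int) : A :=
  (rho * (q + q^-1)) *: (comm (zext p i) (zext m (j - 1))
                         - comm (zext p (i - 1)) (zext m j))
  + (q - q^-1) *: (zext z i * zext t j - zext z j * zext t i).

Definition cross_rel2 (p m z t : nat -> A) (i j : int) : A :=
  comm (zext t i) (zext z (j - 1)) - comm (zext t (i - 1)) (zext z j)
  + ((q - q^-1) * (rho * (q + q^-1))) *:
    (zext m (i - 1) * zext p (j - 1) - zext m (j - 1) * zext p (i - 1)).

Lemma self_relW x :
  (forall k l, I (comm (x k) (x l))) -> forall i j, I (self_rel x i j).
Proof.
move=> xx; have zz i j : I (comm (zext x i) (zext x j)).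
  case: i j => i [] j //=; apply: (ideal_zero idI);
  by rewrite /comm !(mulr0, mul0r) subr0.
by move=> i j; apply: B; apply: Z.
Qed.

Lemma self_relP x :
  (forall i j, I (self_rel x i j)) -> forall k l, I (comm (x k) (x l)).
Proof.
move=> xx; elim=> [|k IHk] l; apply: (idealZE idI q0).
  apply: (ideal_eq (xx 0%N l.+1)); rewrite /self_rel zext_pred /= /comm.
  by nc_ring A; field.
apply: (ideal_eq (D (xx k.+1 l.+1) (Z q^-1 (IHk l.+1)))).
by rewrite /self_rel !zext_pred /= /comm; nc_ring A; field.
Qed.

Section Mixed.
Variables (o : bool) (x y : nat -> A).

(* The q-commutator of x_0 and y_k being rho x_k, both sides are the same     *)
(* iterated q-commutator of x_0 with y_k and y_l, up to a multiple of rho.    *)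
Lemma oqcomm_sym :
    (forall k, I (oqcomm o (x 0) (y k) - rho *: x k)) ->
    (forall k l, I (comm (y k) (y l))) ->
  forall k l, I (oqcomm o (x k) (y l) - oqcomm o (x l) (y k)).
Proof.
move=> xy yy k l; apply: (idealZE idI rho0).
case: o xy => /= xy; rewrite /oqcomm /= in xy *.
  apply: (ideal_eq (B
    (D (Z (q ^+ 2) (MR (x 0) (yy l k))) (Z (q ^- 2) (ML (x 0) (yy k l))))
    (B (ideal_qcommutl idI q (y l) (xy k))
       (ideal_qcommutl idI q (y k) (xy l))))).
  rewrite /comm /qcomm; nc_ring A; field; by rewrite ?q0.
apply: (ideal_eq (B
  (D (Z (q ^+ 2) (ML (x 0) (yy k l))) (Z (q ^- 2) (MR (x 0) (yy l k))))
  (B (ideal_qcommr idI q (y l) (xy k)) (ideal_qcommr idI q (y k) (xy l))))).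
rewrite /comm /qcomm; nc_ring A; field; by rewrite ?q0.
Qed.

Hypothesis y0 : exists a : F, y 0 = a%:A.

Lemma mixed_relW :
    (forall k l, I (oqcomm o (x k) (y l) - oqcomm o (x l) (y k))) ->
    (forall k l, I (ocomm o (x k) (y l.+1) - ocomm o (x l) (y k.+1))) ->
  forall i j, I (mixed_rel1 o x y i j) /\ I (mixed_rel2 o x y i j).
Proof.
have [a ya] := y0.
move=> xyq xyc [i|i] [[|j]|j]; rewrite /mixed_rel1 /mixed_rel2 ?zextE.
- case: i => [|i]; rewrite ?zextE.
    by split; apply: (ideal_zero idI); rewrite ya /omul; case: o;
      nc_ring A; field; rewrite ?q0.
  split; first by apply: (ideal_zero idI); rewrite ya /omul; case: o;
    nc_ring A; field; rewrite ?q0.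
  apply: (ideal_eq (Z q^-1 (xyq 0%N i))).
  by rewrite ya /oqcomm /omul; case: o; nc_ring A; field; rewrite ?q0.
- case: i => [|i]; rewrite ?zextE.
    split; last by apply: (ideal_zero idI); rewrite ya /omul; case: o;
      nc_ring A; field; rewrite ?q0.
    apply: (ideal_eq (xyq 0%N j)).
    by rewrite ya /oqcomm /omul; case: o; nc_ring A; field; rewrite ?q0.
  split.
    apply: (ideal_eq (D (xyq i.+1 j) (Z q^-1 (xyc j i)))).
    by rewrite /oqcomm /ocomm /omul; case: o; nc_ring A; field; rewrite ?q0.
  apply: (ideal_eq (D (Z q^-1 (xyq j.+1 i)) (xyc i j))).
  by rewrite /oqcomm /ocomm /omul; case: o; nc_ring A; field; rewrite ?q0.
all: split; apply: (ideal_zero idI); rewrite /omul;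
  by case: o; nc_ring A; field; rewrite ?q0.
Qed.

Lemma mixed_relP :
    (forall i j, I (mixed_rel1 o x y i j) /\ I (mixed_rel2 o x y i j)) ->
    (forall k l, I (ocomm o (x k) (y l.+1) - ocomm o (x l) (y k.+1))) /\
    (forall k, I (oqcomm o (x 0) (y k) - oqcomm o (x k) (y 0))).
Proof.
have [a ya] := y0; move=> xy; split=> [k l|k].
  apply: (idealZE idI (c := (q ^+ 2 - 1) / q)).
    by rewrite mulf_neq0 ?invr_eq0.
  apply: (ideal_eq (B (Z q (xy k.+1 l.+1).2) (xy l.+1 k.+1).1)).
  rewrite /mixed_rel1 /mixed_rel2 !zextE /ocomm /omul.
  by case: o; nc_ring A; field; rewrite ?q0.
apply: (ideal_eq (xy 0%N k.+1).1).
rewrite /mixed_rel1 !zextE ya /oqcomm /omul.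
by case: o; nc_ring A; field; rewrite ?q0.
Qed.

End Mixed.

(* p_k, m_k, z_k and t_k stand for y_(k+1), y_(-k), z_k and \tilde z_k, where *)
(* z_0 and t_0 are the scalars of the paper.                                  *)
Section Cross.
Variables p m z t : nat -> A.
Local Notation qp := (q + q^-1).
Hypothesis z0 : z 0 = (rho / (q - q^-1))%:A.
Hypothesis t0 : t 0 = (rho / (q - q^-1))%:A.

Section CrossW.
Hypotheses
  (pm0 : forall l, I (comm (p 0) (m l) - qp^-1 *: (z l.+1 - t l.+1)))
  (p0m : forall k, I (comm (p k) (m 0) - qp^-1 *: (z k.+1 - t k.+1)))
  (pt : forall k, I (qcomm q (p 0) (t k) - rho *: p k))
  (tt : forall k l, I (comm (t k) (t l)))
  (pm : forall k l, I (comm (p k) (m l) - comm (p l) (m k)))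
  (mt : forall k l, I (comm (m k) (t l.+1) - comm (m l) (t k.+1)))
  (tm : forall k l, I (qcomm q (t k) (m l) - qcomm q (t l) (m k)))
  (zt : forall k l, I (comm (z k) (t l) - comm (z l) (t k))).

Lemma cross_rel1W i j : I (cross_rel1 p m z t i j).
Proof.
have qp0 := qp_neq0.
case: i j => [i|i] [j|j]; rewrite /cross_rel1 ?zextE.
- case: i j => [|k] [|l]; rewrite ?zextE.
  + apply: (ideal_zero idI); rewrite t0 z0 /comm.
    by nc_ring A; field; rewrite ?q0.
  + apply: (ideal_eq (Z (rho * qp) (pm0 l))); rewrite t0 z0 /comm.
    by nc_ring A; field; rewrite ?q0 ?q1 ?q2.
  + apply: (ideal_eq (Z (- (rho * qp)) (p0m k))); rewrite t0 z0 /comm.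
    by nc_ring A; field; rewrite ?q0 ?q1 ?q2.
  + apply: (ideal_eq (
      D (B (Z qp (B (ideal_commr idI (m k) (pt l.+1))
                    (ideal_commr idI (m l) (pt k.+1))))
           (Z (rho * qp) (pm k l.+1)))
        (D (Z qp (B (B (ideal_qcommr idI q (t k.+1) (pm0 l))
                       (ideal_qcommr idI q (t l.+1) (pm0 k)))
                    (ideal_qcommutl idI q (p 0) (mt l k))))
           (D (Z qp (tt k.+1 l.+1)) (Z q^-1 (zt l.+1 k.+1)))))).
    rewrite /qcomm /comm; by nc_ring A; field; rewrite ?q0 ?q1 ?q2.
all: apply: (ideal_zero idI); rewrite /comm; by nc_ring A; field; rewrite ?q0.
Qed.

Lemma cross_rel2W i j : I (cross_rel2 p m z t i j).
Proof.
have qp0 := qp_neq0.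
case: i j => [i|i] [j|j]; rewrite /cross_rel2 ?zextE.
- case: i j => [|k] [|l]; rewrite ?zextE.
  4: apply: (ideal_eq (D
      (B (B (B (tt l k.+1) (tt k l.+1)) (zt l k.+1))
         (Z qp (B (ideal_commutl idI (t l) (pm0 k))
                  (ideal_commutl idI (t k) (pm0 l)))))
      (Z qp (D (B (Z q (B (MR (m l) (pt k)) (MR (m k) (pt l))))
                  (Z (q * rho) (pm l k)))
               (D (Z q^-1 (B (ML (m k) (pt l)) (ML (m l) (pt k))))
                  (B (Z q (ML (p 0) (tm l k)))
                     (Z q^-1 (MR (p 0) (tm l k))))))))).
  4: rewrite /qcomm /comm; by nc_ring A; field; rewrite ?q0 ?q1 ?q2.
  all: apply: (ideal_zero idI); rewrite ?t0 ?z0 /comm.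
  all: by nc_ring A; field; rewrite ?q0.
all: apply: (ideal_zero idI); rewrite /comm; by nc_ring A; field; rewrite ?q0.
Qed.

End CrossW.
Lemma cross_rel1P :
    (forall i j, I (cross_rel1 p m z t i j)) ->
  [/\ forall l, I (comm (p 0) (m l) - qp^-1 *: (z l.+1 - t l.+1)),
      forall k, I (comm (p k) (m 0) - qp^-1 *: (z k.+1 - t k.+1))
    & forall k l, I (comm (p k) (m l) - comm (p l) (m k))].
Proof.
have qp0 := qp_neq0.
have c0 : rho * qp != 0 by rewrite mulf_neq0.
move=> F1; split=> [l|k|].
- apply: (idealZE idI c0); apply: (ideal_eq (F1 0%N l.+1)).
  rewrite /cross_rel1 !zextE t0 z0 /comm.
  by nc_ring A; field; rewrite ?q0 ?q1 ?q2.
- apply: (idealZE idI c0); apply: (ideal_eq (N (F1 k.+1 0%N))).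
  rewrite /cross_rel1 !zextE t0 z0 /comm.
  by nc_ring A; field; rewrite ?q0 ?q1 ?q2.
elim=> [|k IHk] l; apply: (idealZE idI c0).
  apply: (ideal_eq (D (F1 0%N l.+1) (F1 l.+1 0%N))).
  by rewrite /cross_rel1 !zextE /comm; nc_ring A; field; rewrite ?q0.
apply: (ideal_eq (D (D (F1 k.+1 l.+1) (F1 l.+1 k.+1))
                    (Z (rho * qp) (IHk l.+1)))).
by rewrite /cross_rel1 !zextE /comm; nc_ring A; field; rewrite ?q0.
Qed.

Lemma cross_rel2P :
    (forall i j, I (cross_rel2 p m z t i j)) ->
  forall k l, I (comm (t k) (z l) - comm (t l) (z k)).
Proof.
move=> F3; elim=> [|k IHk] l.
  apply: (ideal_zero idI); rewrite t0 z0 /comm.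
  by nc_ring A; field; rewrite ?q0.
apply: (ideal_eq (D (D (F3 k.+1 l.+1) (F3 l.+1 k.+1)) (IHk l.+1))).
by rewrite /cross_rel2 !zextE /comm; nc_ring A; field; rewrite ?q0.
Qed.

Lemma telescope_qsum (N : nat) (X : int -> int -> A) :
    (forall i, X i (-1) = 0) -> (forall j, X (-1) j = 0) ->
  \sum_(0 <= i < N.+2) q ^ (2 * i%:Z - N%:Z - 1) *:
      (X i ((N.+1 - i)%N%:Z - 1) - X (i%:Z - 1) (N.+1 - i)%N)
  = (q^-1 - q) *: \sum_(0 <= k < N.+1) q ^ (2 * k%:Z - N%:Z) *: X k (N - k)%N.
Proof.
move=> X1 X2; under eq_bigr do rewrite scalerBr.
rewrite big_split /= big_nat_recr //= subnn sub0r X1 scaler0 addr0.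
rewrite [X in _ + X]big_nat_recl //= sub0r X2 scaler0 oppr0 add0r.
rewrite -big_split scaler_sumr /=; apply: eq_big_nat => k /andP[_ kN].
have -> : k.+1%:Z - 1 = k by lia.
have -> : (N.+1 - k)%N%:Z - 1 = (N - k)%N by lia.
rewrite subSS -scalerBl scalerA; congr (_ *: _).
have -> : 2 * k.+1%:Z - N%:Z - 1 = (2 * k%:Z - N%:Z) + 1 by lia.
by rewrite !expfzDr // expr1z exprN1 mulrBl; congr (_ - _); rewrite mulrC.
Qed.

Definition wsum (f : nat -> F) (x : nat -> A) (n : nat) : A :=
  \sum_(0 <= k < n) f k *: x k.

Definition det_rel (p m z t : nat -> A) (n : nat) : A :=
  (rho * qp) *:
    wsum (fun k => q ^ (2 * k%:Z - n%:Z)) (fun k => p k * m (n - k)%N) n.+1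
  - wsum (fun k => q ^ (2 * k%:Z - n%:Z - 1))
      (fun k => z k * t (n.+1 - k)%N) n.+2.

(* Both determinants agree because the relations [cross_rel1] and             *)
(* [cross_rel2], whose generating functions carry a factor S - T, can be      *)
(* evaluated at S = q^-2 T.                                                   *)
Lemma det_rel_swap n :
    (forall i j, I (cross_rel1 p m z t i j)) ->
    (forall i j, I (cross_rel2 p m z t i j)) ->
  I (det_rel p m z t n - det_rel m p t z n).
Proof.
move=> F1 F3.
have c0 : q^-1 - q != 0.
  have -> : q^-1 - q = - ((q ^+ 2 - 1) / q) by field.
  by rewrite oppr_eq0 mulf_neq0 ?invr_eq0.
apply: (idealZE idI c0).
pose w (k : nat) := q ^ (2 * k%:Z - n%:Z).
pose w' (k : nat) := q ^ (2 * k%:Z - n%:Z - 1).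
have J1 : I (\sum_(0 <= i < n.+2) w' i *: cross_rel1 p m z t i (n.+1 - i)%N).
  by apply: (ideal_sum idI) => i _; apply: Z.
have J2 : I (\sum_(0 <= i < n.+3)
    q ^ (2 * i%:Z - n.+1%:Z - 1) *: cross_rel2 p m z t i (n.+2 - i)%N).
  by apply: (ideal_sum idI) => i _; apply: Z.
have comm00 x : comm x 0 = 0 /\ comm 0 x = 0 :> A.
  by rewrite /comm !(mulr0, mul0r) subr0.
have T1 := telescope_qsum n (X := fun i j => comm (zext p i) (zext m j))
  (fun i => (comm00 _).1) (fun j => (comm00 _).2).
have T2 := telescope_qsum n.+1 (X := fun i j => comm (zext t i) (zext z j))
  (fun i => (comm00 _).1) (fun j => (comm00 _).2).
have sumZD (f : nat -> F) (a b : F) (g h : nat -> A) k :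
    \sum_(0 <= i < k) f i *: (a *: g i + b *: h i) =
    a *: (\sum_(0 <= i < k) f i *: g i) + b *: (\sum_(0 <= i < k) f i *: h i).
  rewrite !scaler_sumr -big_split; apply: eq_bigr => i _ /=.
  by rewrite scalerDr !scalerA ![f i * _]mulrC.
have E1 : \sum_(0 <= i < n.+2) w' i *: cross_rel1 p m z t i (n.+1 - i)%N =
    (q^-1 - q) *:
      ((rho * qp) *: \sum_(0 <= k < n.+1) w k *: comm (p k) (m (n - k)%N)
       - \sum_(0 <= k < n.+2)
           w' k *: (z k * t (n.+1 - k)%N - z (n.+1 - k)%N * t k)).
  rewrite /cross_rel1 sumZD T1 -[q - q^-1]opprB scaleNr scalerBr !scalerA.
  by rewrite [_ * (q^-1 - q)]mulrC.
have E2 : \sum_(0 <= i < n.+3)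
      q ^ (2 * i%:Z - n.+1%:Z - 1) *: cross_rel2 p m z t i (n.+2 - i)%N =
    (q^-1 - q) *: (\sum_(0 <= k < n.+2) w' k *: comm (t k) (z (n.+1 - k)%N)
      - (rho * qp) *: \sum_(0 <= k < n.+1)
          w k *: (m k * p (n - k)%N - m (n - k)%N * p k)).
  have shiftE : \sum_(0 <= i < n.+3) q ^ (2 * i%:Z - n.+1%:Z - 1) *:
      (zext m (i%:Z - 1) * zext p ((n.+2 - i)%N%:Z - 1)
       - zext m ((n.+2 - i)%N%:Z - 1) * zext p (i%:Z - 1))
    = \sum_(0 <= k < n.+1) w k *: (m k * p (n - k)%N - m (n - k)%N * p k).
    rewrite big_nat_recr // big_nat_recl //= subnn !zextE !(mulr0, mul0r) subr0.
    rewrite !scaler0 add0r addr0; apply: eq_big_nat => k /andP[_ kn].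
    rewrite subSS subSn -1?ltnS // !zextE /w; congr (_ *: _).
      by congr (q ^ _); lia.
    by rewrite subn0 subSS.
  have w'E i : q ^ (2 * i%:Z - n.+1%:Z) = w' i by congr (q ^ _); lia.
  under eq_bigr do rewrite /cross_rel2 -[comm _ _ - _]scale1r.
  rewrite sumZD T2 shiftE scale1r; under [in LHS]eq_bigr do rewrite w'E.
  rewrite scalerBr -[q - q^-1]opprB mulNr scaleNr -scalerA; congr (_ *: _ - _).
apply: (ideal_eq (D J1 J2)); rewrite E1 E2 /det_rel.
rewrite -scalerDr; congr (_ *: _).
have wsumB f (g h : nat -> A) k :
    \sum_(0 <= i < k) f i *: (g i - h i) = wsum f g k - wsum f h k.
  by rewrite -sumrB; apply: eq_bigr => i _; rewrite scalerBr.
rewrite /comm !wsumB /w /w'.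
by nc_ring A; field.
Qed.

End Cross.
End CoefficientRelations.

Section Presentations.
Variables (F : fieldType) (q : F) (A : algType F) (I : A -> Prop).
Hypotheses (q0 : q != 0) (q1 : q ^+ 2 - 1 != 0) (q2 : q ^+ 2 + 1 != 0).
Hypothesis idI : two_sided_ideal I.
Variables p m z t : nat -> A.

Local Notation rho := (rhobar q).
Local Notation qp := (q + q^-1).
Local Notation D := (idealD idI).
Local Notation B := (idealB idI).
Local Notation N := (idealN idI).
Local Notation Z := (idealZ idI).

Hypothesis z0 : z 0 = (rho / (q - q^-1))%:A.
Hypothesis t0 : t 0 = (rho / (q - q^-1))%:A.

Record UqT_mod : Prop := UqTMod {
  UqT_p0m : forall k, I (comm (p 0) (m k) - qp^-1 *: (z k.+1 - t k.+1));
  UqT_pm0 : forall k, I (comm (p k) (m 0) - qp^-1 *: (z k.+1 - t k.+1));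
  UqT_p0t : forall k, I (qcomm q (p 0) (t k.+1) - rho *: p k.+1);
  UqT_zp0 : forall k, I (qcomm q (z k.+1) (p 0) - rho *: p k.+1);
  UqT_tm0 : forall k, I (qcomm q (t k.+1) (m 0) - rho *: m k.+1);
  UqT_m0z : forall k, I (qcomm q (m 0) (z k.+1) - rho *: m k.+1);
  UqT_pp : forall k l, I (comm (p k) (p l));
  UqT_mm : forall k l, I (comm (m k) (m l));
  UqT_pm : forall k l, I (comm (p k) (m l) + comm (m k) (p l));
  UqT_pt : forall k l, I (comm (p k) (t l.+1) + comm (t k.+1) (p l));
  UqT_pz : forall k l, I (comm (p k) (z l.+1) + comm (z k.+1) (p l));
  UqT_mt : forall k l, I (comm (m k) (t l.+1) + comm (t k.+1) (m l));
  UqT_mz : forall k l, I (comm (m k) (z l.+1) + comm (z k.+1) (m l));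
  UqT_tt : forall k l, I (comm (t k.+1) (t l.+1));
  UqT_zz : forall k l, I (comm (z k.+1) (z l.+1));
  UqT_ztc : forall k l, I (comm (z k.+1) (t l.+1) + comm (t k.+1) (z l.+1));
  UqT_detm : forall n, I (det_rel q p m z t n) }.

Record RKRK_mod : Prop := RKRKMod {
  RKRK_p : forall i j, I (self_rel q p i j);
  RKRK_m : forall i j, I (self_rel q m i j);
  RKRK_z : forall i j, I (self_rel q z i j);
  RKRK_t : forall i j, I (self_rel q t i j);
  RKRK_pt : forall i j,
    I (mixed_rel1 q false p t i j) /\ I (mixed_rel2 q false p t i j);
  RKRK_mz : forall i j,
    I (mixed_rel1 q false m z i j) /\ I (mixed_rel2 q false m z i j);
  RKRK_pz : forall i j,
    I (mixed_rel1 q true p z i j) /\ I (mixed_rel2 q true p z i j);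
  RKRK_mt : forall i j,
    I (mixed_rel1 q true m t i j) /\ I (mixed_rel2 q true m t i j);
  RKRK_pm1 : forall i j, I (cross_rel1 q p m z t i j);
  RKRK_mp1 : forall i j, I (cross_rel1 q m p t z i j);
  RKRK_pm2 : forall i j, I (cross_rel2 q p m z t i j);
  RKRK_mp2 : forall i j, I (cross_rel2 q m p t z i j) }.

Lemma UqT_modW : UqT_mod -> RKRK_mod.
Proof.
case=> p0m pm0 p0t zp0 tm0 m0z pp mm pm pt pz mt mz tt zz zt _.
have qm0 := qm_neq0 q0 q1; have qp0 := qp_neq0 q0 q2.
have cz : exists a : F, z 0 = a%:A by eexists; exact: z0.
have ct : exists a : F, t 0 = a%:A by eexists; exact: t0.
have t_t k l : I (comm (t k) (t l)).
  case: k l => [|k] [|l] //; apply: (ideal_zero idI); rewrite t0 /comm;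
  by nc_ring A; ring.
have z_z k l : I (comm (z k) (z l)).
  case: k l => [|k] [|l] //; apply: (ideal_zero idI); rewrite z0 /comm;
  by nc_ring A; ring.
have pt0 k : I (oqcomm q false (p 0) (t k) - rho *: p k).
  case: k => [|k]; last exact: p0t.
  apply: (ideal_zero idI); rewrite t0 /oqcomm /omul.
  by nc_ring A; field; rewrite ?q0 ?q1.
have pz0 k : I (oqcomm q true (p 0) (z k) - rho *: p k).
  case: k => [|k]; last exact: zp0.
  apply: (ideal_zero idI); rewrite z0 /oqcomm /omul.
  by nc_ring A; field; rewrite ?q0 ?q1.
have mt0 k : I (oqcomm q true (m 0) (t k) - rho *: m k).
  case: k => [|k]; last exact: tm0.
  apply: (ideal_zero idI); rewrite t0 /oqcomm /omul.
  by nc_ring A; field; rewrite ?q0 ?q1.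
have mz0 k : I (oqcomm q false (m 0) (z k) - rho *: m k).
  case: k => [|k]; last exact: m0z.
  apply: (ideal_zero idI); rewrite z0 /oqcomm /omul.
  by nc_ring A; field; rewrite ?q0 ?q1.
have symD (x y : nat -> A) :
    (forall k l, I (comm (x k) (y l) + comm (y k) (x l))) ->
    forall k l, I (comm (x k) (y l) - comm (x l) (y k)).
  by move=> H k l; apply: (ideal_eq (H k l)); rewrite /comm; nc_ring A; ring.
pose t' k := t k.+1; pose z' k := z k.+1.
have ptD := symD p t' pt; have pzD := symD p z' pz.
have mtD := symD m t' mt; have mzD := symD m z' mz.
have pmD := symD p m pm.
have ocommN (x y : nat -> A) :
    (forall k l, I (comm (x k) (y l.+1) - comm (x l) (y k.+1))) ->
    forall k l, I (ocomm true (x k) (y l.+1) - ocomm true (x l) (y k.+1)).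
  move=> H k l; apply: (ideal_eq (N (H k l))); rewrite /ocomm /omul /comm.
  by nc_ring A; ring.
have ztD k l : I (comm (z k) (t l) - comm (z l) (t k)).
  case: k l => [|k] [|l]; last exact: (symD z' t' zt);
    by apply: (ideal_zero idI); rewrite ?z0 ?t0 /comm; nc_ring A; ring.
have mpD k l : I (comm (m k) (p l) - comm (m l) (p k)).
  by apply: (ideal_eq (pmD k l)); rewrite /comm; nc_ring A; ring.
have tzD k l : I (comm (t k) (z l) - comm (t l) (z k)).
  by apply: (ideal_eq (ztD k l)); rewrite /comm; nc_ring A; ring.
have m0p k : I (comm (m 0) (p k) - qp^-1 *: (t k.+1 - z k.+1)).
  by apply: (ideal_eq (N (pm0 k))); rewrite /comm; nc_ring A; ring.
have mp0 k : I (comm (m k) (p 0) - qp^-1 *: (t k.+1 - z k.+1)).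
  by apply: (ideal_eq (N (p0m k))); rewrite /comm; nc_ring A; ring.
have tmS k l : I (qcomm q (t k) (m l) - qcomm q (t l) (m k)).
  exact: (oqcomm_sym q0 q1 q2 idI mt0 t_t l k).
have zpS k l : I (qcomm q (z k) (p l) - qcomm q (z l) (p k)).
  exact: (oqcomm_sym q0 q1 q2 idI pz0 z_z l k).
split.
- exact: self_relW.
- exact: self_relW.
- exact: self_relW.
- exact: self_relW.
- exact: (mixed_relW q0 idI ct (oqcomm_sym q0 q1 q2 idI pt0 t_t) ptD).
- exact: (mixed_relW q0 idI cz (oqcomm_sym q0 q1 q2 idI mz0 z_z) mzD).
- exact: (mixed_relW q0 idI cz (oqcomm_sym q0 q1 q2 idI pz0 z_z)
    (ocommN _ _ pzD)).
- exact: (mixed_relW q0 idI ct (oqcomm_sym q0 q1 q2 idI mt0 t_t)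
    (ocommN _ _ mtD)).
- exact: (cross_rel1W q0 q1 q2 idI z0 t0 p0m pm0 pt0 t_t pmD mtD ztD).
- exact: (cross_rel1W q0 q1 q2 idI t0 z0 m0p mp0 mz0 z_z mpD pzD tzD).
- exact: (cross_rel2W q0 q1 q2 idI z0 t0 p0m pt0 t_t pmD tmS ztD).
- exact: (cross_rel2W q0 q1 q2 idI t0 z0 m0p mz0 z_z mpD zpS tzD).
Qed.

Lemma UqT_modP :
  RKRK_mod -> (forall n, I (det_rel q p m z t n)) -> UqT_mod.
Proof.
have qm0 := qm_neq0 q0 q1; have qp0 := qp_neq0 q0 q2.
have cz : exists a : F, z 0 = a%:A by eexists; exact: z0.
have ct : exists a : F, t 0 = a%:A by eexists; exact: t0.
case=> pp mm zz tt pt mz pz mt pm1 _ pm2 _ det.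
have [p0m pm0 pm] := cross_rel1P q0 q1 q2 idI z0 t0 pm1.
have tz := cross_rel2P q0 q1 idI z0 t0 pm2.
have [ptW ptS] := mixed_relP q0 q1 idI ct pt.
have [mtW mtS] := mixed_relP q0 q1 idI ct mt.
have [pzW pzS] := mixed_relP q0 q1 idI cz pz.
have [mzW mzS] := mixed_relP q0 q1 idI cz mz.
split=> //.
- move=> k; apply: (ideal_eq (ptS k.+1)); rewrite t0 /oqcomm /omul /qcomm.
  by nc_ring A; field; rewrite ?q0 ?q1.
- move=> k; apply: (ideal_eq (pzS k.+1)); rewrite z0 /oqcomm /omul /qcomm.
  by nc_ring A; field; rewrite ?q0 ?q1.
- move=> k; apply: (ideal_eq (mtS k.+1)); rewrite t0 /oqcomm /omul /qcomm.
  by nc_ring A; field; rewrite ?q0 ?q1.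
- move=> k; apply: (ideal_eq (mzS k.+1)); rewrite z0 /oqcomm /omul /qcomm.
  by nc_ring A; field; rewrite ?q0 ?q1.
- exact: (self_relP q0 idI pp).
- exact: (self_relP q0 idI mm).
- move=> k l; apply: (ideal_eq (pm k l)); rewrite /comm.
  by nc_ring A; ring.
- move=> k l; apply: (ideal_eq (ptW k l)); rewrite /ocomm /omul /comm.
  by nc_ring A; ring.
- move=> k l; apply: (ideal_eq (N (pzW k l))); rewrite /ocomm /omul /comm.
  by nc_ring A; ring.
- move=> k l; apply: (ideal_eq (N (mtW k l))); rewrite /ocomm /omul /comm.
  by nc_ring A; ring.
- move=> k l; apply: (ideal_eq (mzW k l)); rewrite /ocomm /omul /comm.
  by nc_ring A; ring.
- by move=> k l; exact: (self_relP q0 idI tt).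
- by move=> k l; exact: (self_relP q0 idI zz).
- move=> k l; apply: (ideal_eq (tz k.+1 l.+1)); rewrite /comm.
  by nc_ring A; ring.
Qed.

End Presentations.

(** * Entries of the Freidel-Maillet equation *)

Section FourByFour.
Variables (F : fieldType) (q : F) (B : algType F).

Lemma mx4M (s r : seq (seq B)) (i j : 'I_(2 * 2)) :
  (mx4 s *m mx4 r) i j =
  (nth 0 (nth [::] s i) 0 * nth 0 (nth [::] r 0) j
   + nth 0 (nth [::] s i) 1 * nth 0 (nth [::] r 1) j
   + (nth 0 (nth [::] s i) 2 * nth 0 (nth [::] r 2) j
      + nth 0 (nth [::] s i) 3 * nth 0 (nth [::] r 3) j)).
Proof. by rewrite mxE !big_ord_recl big_ord0 !mxE addr0 /= addrA. Qed.

Lemma tens1_mx4 (U : 'M[B]_2) :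
  U *t 1%:M = mx4 [:: [:: U 0 0; 0; U 0 1; 0]; [:: 0; U 0 0; 0; U 0 1];
                      [:: U 1 0; 0; U 1 1; 0]; [:: 0; U 1 0; 0; U 1 1]].
Proof.
apply/matrixP => i j; rewrite !mxE.
case: i => [[|[|[|[|//]]]] Hi]; case: j => [[|[|[|[|//]]]] Hj] /=;
  rewrite ?mulr1 ?mulr0 //; congr (U _ _); exact: val_inj.
Qed.

Lemma tens1l_mx4 (V : 'M[B]_2) :
  1%:M *t V = mx4 [:: [:: V 0 0; V 0 1; 0; 0]; [:: V 1 0; V 1 1; 0; 0];
                      [:: 0; 0; V 0 0; V 0 1]; [:: 0; 0; V 1 0; V 1 1]].
Proof.
apply/matrixP => i j; rewrite !mxE.
case: i => [[|[|[|[|//]]]] Hi]; case: j => [[|[|[|[|//]]]] Hj] /=;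
  rewrite ?mul1r ?mul0r //; congr (V _ _); exact: val_inj.
Qed.

Lemma mx4_R0 (s : seq (seq B)) :
  mx4 s *m R0mx q B = \matrix_(i, j)
    (nth 0 (nth [::] s i) j * nth 0 [:: 1; q^-1%:A; q^-1%:A; 1] j).
Proof.
apply/matrixP => i j; rewrite mx4M !mxE.
by case: j => [[|[|[|[|//]]]] Hj] /=; rewrite !mulr0 ?addr0 ?add0r.
Qed.

Definition KRK_seq (U V : 'M[B]_2) : seq (seq B) :=
  [:: [:: U 0 0 * V 0 0; U 0 0 * V 0 1;
          q^-1 *: (U 0 1 * V 0 0); q^-1 *: (U 0 1 * V 0 1)];
      [:: q^-1 *: (U 0 0 * V 1 0); q^-1 *: (U 0 0 * V 1 1);
          U 0 1 * V 1 0; U 0 1 * V 1 1];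
      [:: U 1 0 * V 0 0; U 1 0 * V 0 1;
          q^-1 *: (U 1 1 * V 0 0); q^-1 *: (U 1 1 * V 0 1)];
      [:: q^-1 *: (U 1 0 * V 1 0); q^-1 *: (U 1 0 * V 1 1);
          U 1 1 * V 1 0; U 1 1 * V 1 1]].
Definition KRK_op_seq (U V : 'M[B]_2) : seq (seq B) :=
  [:: [:: V 0 0 * U 0 0; q^-1 *: (V 0 1 * U 0 0);
          V 0 0 * U 0 1; q^-1 *: (V 0 1 * U 0 1)];
      [:: V 1 0 * U 0 0; q^-1 *: (V 1 1 * U 0 0);
          V 1 0 * U 0 1; q^-1 *: (V 1 1 * U 0 1)];
      [:: q^-1 *: (V 0 0 * U 1 0); V 0 1 * U 1 0;
          q^-1 *: (V 0 0 * U 1 1); V 0 1 * U 1 1];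
      [:: q^-1 *: (V 1 0 * U 1 0); V 1 1 * U 1 0;
          q^-1 *: (V 1 0 * U 1 1); V 1 1 * U 1 1]].

Lemma KRK_mx4 (U V : 'M[B]_2) :
  U *t 1%:M *m R0mx q B *m (1%:M *t V) =
  mx4 (KRK_seq U V).
Proof.
rewrite tens1_mx4 tens1l_mx4 mx4_R0.
apply/matrixP => i j; rewrite !mxE !big_ord_recl big_ord0 !mxE.
case: i => [[|[|[|[|//]]]] Hi]; case: j => [[|[|[|[|//]]]] Hj] /=;
  by rewrite !(mul0r, mulr0, addr0, add0r, mulr1) // mulr_algr -scalerAl.
Qed.

Lemma KRK_mx4_op (U V : 'M[B]_2) :
  1%:M *t V *m R0mx q B *m (U *t 1%:M) =
  mx4 (KRK_op_seq U V).
Proof.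
rewrite tens1_mx4 tens1l_mx4 mx4_R0.
apply/matrixP => i j; rewrite !mxE !big_ord_recl big_ord0 !mxE.
case: i => [[|[|[|[|//]]]] Hi]; case: j => [[|[|[|[|//]]]] Hj] /=;
  by rewrite !(mul0r, mulr0, addr0, add0r, mulr1) // mulr_algr -scalerAl.
Qed.

Lemma RM_mx4 (w wV : B) (s : seq (seq B)) (i j : 'I_(2 * 2)) :
  (Rmx q w wV *m mx4 s) i j =
  nth 0 [:: (q *: w - q^-1 *: wV) * nth 0 (nth [::] s 0) j;
            (w - wV) * nth 0 (nth [::] s 1) j
            + (q - q^-1) *: nth 0 (nth [::] s 2) j;
            (q - q^-1) *: nth 0 (nth [::] s 1) j
            + (w - wV) * nth 0 (nth [::] s 2) j;
            (q *: w - q^-1 *: wV) * nth 0 (nth [::] s 3) j] i.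
Proof.
rewrite mx4M; case: i => [[|[|[|[|//]]]] Hi] /=;
  by rewrite !(mul0r, addr0, add0r) ?mulr_algl.
Qed.

Lemma MR_mx4 (w wV : B) (s : seq (seq B)) (i j : 'I_(2 * 2)) :
  (mx4 s *m Rmx q w wV) i j =
  nth 0 [:: nth 0 (nth [::] s i) 0 * (q *: w - q^-1 *: wV);
            nth 0 (nth [::] s i) 1 * (w - wV)
            + (q - q^-1) *: nth 0 (nth [::] s i) 2;
            (q - q^-1) *: nth 0 (nth [::] s i) 1
            + nth 0 (nth [::] s i) 2 * (w - wV);
            nth 0 (nth [::] s i) 3 * (q *: w - q^-1 *: wV)] j.
Proof.
rewrite mx4M; case: j => [[|[|[|[|//]]]] Hj] /=;
  by rewrite !(mulr0, addr0, add0r) ?mulr_algr.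
Qed.

Definition RKRK_lmx (w wV : B) (U V : 'M[B]_2) : 'M[B]_(2 * 2) :=
  Rmx q w wV *m (U *t 1%:M) *m R0mx q B *m (1%:M *t V).
Definition RKRK_rmx (w wV : B) (U V : 'M[B]_2) : 'M[B]_(2 * 2) :=
  1%:M *t V *m R0mx q B *m (U *t 1%:M) *m Rmx q w wV.

Lemma RKRK_lmxE w wV U V i j :
  RKRK_lmx w wV U V i j =
  let s := KRK_seq U V in
  nth 0 [:: (q *: w - q^-1 *: wV) * nth 0 (nth [::] s 0) j;
            (w - wV) * nth 0 (nth [::] s 1) j
            + (q - q^-1) *: nth 0 (nth [::] s 2) j;
            (q - q^-1) *: nth 0 (nth [::] s 1) j
            + (w - wV) * nth 0 (nth [::] s 2) j;
            (q *: w - q^-1 *: wV) * nth 0 (nth [::] s 3) j] i.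
Proof. by rewrite /RKRK_lmx -2!(mulmxA (Rmx q w wV)) KRK_mx4 RM_mx4. Qed.

Lemma RKRK_rmxE w wV U V i j :
  RKRK_rmx w wV U V i j =
  let s := KRK_op_seq U V in
  nth 0 [:: nth 0 (nth [::] s i) 0 * (q *: w - q^-1 *: wV);
            nth 0 (nth [::] s i) 1 * (w - wV)
            + (q - q^-1) *: nth 0 (nth [::] s i) 2;
            (q - q^-1) *: nth 0 (nth [::] s i) 1
            + nth 0 (nth [::] s i) 2 * (w - wV);
            nth 0 (nth [::] s i) 3 * (q *: w - q^-1 *: wV)] j.
Proof. by rewrite /RKRK_rmx KRK_mx4_op MR_mx4. Qed.

End FourByFour.

Section Entries.
Variables (F : fieldType) (A : algType F).
Implicit Types (f g : laurent A) (x : laurent (laurent A)) (n m : int).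

Definition u_v : laurent (laurent A) := lmono (-1) (lmono 1 1).
Definition v_u : laurent (laurent A) := lmono 1 (lmono (-1) 1).

Lemma u_vM x n m : (u_v * x) n m = x (n + 1) (m - 1).
Proof. by rewrite lmonoM lmonoM mul1r opprK. Qed.
Lemma v_uM x n m : (v_u * x) n m = x (n - 1) (m + 1).
Proof. by rewrite lmonoM lmonoM mul1r opprK. Qed.
Lemma Mu_v x n m : (x * u_v) n m = x (n + 1) (m - 1).
Proof. by rewrite lMmono lMmono mulr1 opprK. Qed.
Lemma Mv_u x n m : (x * v_u) n m = x (n - 1) (m + 1).
Proof. by rewrite lMmono lMmono mulr1 opprK. Qed.

Lemma in_uv f g n m : (in_u f * in_v g) n m = f m * g n.
Proof. by rewrite lmonoM subr0 lMmono subr0. Qed.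
Lemma in_vu f g n m : (in_v g * in_u f) n m = g n * f m.
Proof. by rewrite lMmono subr0 lmonoM subr0. Qed.
Lemma lcoefD2 (x y : laurent (laurent A)) n m : (x + y) n m = x n m + y n m.
Proof. by []. Qed.
Lemma lcoefZ2 c (x : laurent (laurent A)) n m : (c *: x) n m = c *: x n m.
Proof. by []. Qed.
End Entries.

Section RawRelations.
Variables (F : fieldType) (q : F) (A : algType F).
Implicit Types (f g X Y : int -> A).

(* Coefficients of u^m v^n in f(u) g(v), multiplied by q u / v - v / (q u) in *)
(* [acoef] and by u / v - v / u in [bcoef].                                   *)
Definition acoef (n m : int) o f g : A :=
  q *: omul o (f (m - 1)) (g (n + 1)) - q^-1 *: omul o (f (m + 1)) (g (n - 1)).
Definition bcoef (n m : int) o f g : A :=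
  omul o (f (m - 1)) (g (n + 1)) - omul o (f (m + 1)) (g (n - 1)).
Definition ccoef (n m : int) o f g : A := omul o (f m) (g n).

Definition self_coef X n m := acoef n m false X X - acoef n m true X X.
Definition mixed_coef1 o X Y n m :=
  acoef n m o X Y - q^-1 *: bcoef n m (~~ o) X Y
  - (q - q^-1) *: ccoef n m (~~ o) Y X.
Definition mixed_coef2 o X Y n m :=
  q^-1 *: acoef n m o Y X - (q^-1 * (q - q^-1)) *: ccoef n m (~~ o) X Y
  - bcoef n m (~~ o) Y X.
Definition cross_coef1 P M Z T n m :=
  q^-1 *: (bcoef n m false P M - bcoef n m true P M)
  + (q - q^-1) *: (ccoef n m false Z T - ccoef n m true T Z).
Definition cross_coef2 P M Z T n m :=
  bcoef n m false T Z - bcoef n m true T Z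
  + (q^-1 * (q - q^-1)) *: (ccoef n m false M P - ccoef n m true P M).

End RawRelations.

Section RKRK.
Variables (F : fieldType) (q : F) (A B : algType F).
Variables (w wV : B) (U V : 'M[B]_2) (k : 'I_2 -> 'I_2 -> int -> A).
(* [co n m] stands for the coefficient of u^m v^n, [w] for u / v, [U] for     *)
(* K(u) and [V] for K(v).                                                     *)
Variable co : int -> int -> B -> A.
Hypotheses
  (coD : forall n m x y, co n m (x + y) = co n m x + co n m y)
  (coZ : forall n m c x, co n m (c *: x) = c *: co n m x)
  (co_wM : forall n m x, co n m (w * x) = co (n + 1) (m - 1) x)
  (co_wVM : forall n m x, co n m (wV * x) = co (n - 1) (m + 1) x)
  (co_Mw : forall n m x, co n m (x * w) = co (n + 1) (m - 1) x)
  (co_MwV : forall n m x, co n m (x * wV) = co (n - 1) (m + 1) x)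
  (co_UV : forall n m a b c d,
    co n m (U a b * V c d) = k a b m * k c d n)
  (co_VU : forall n m a b c d,
    co n m (V c d * U a b) = k c d n * k a b m).

Definition RKRK_diff (i j : 'I_(2 * 2)) (n m : int) : A :=
  co n m (RKRK_lmx q w wV U V i j) - co n m (RKRK_rmx q w wV U V i j).

Definition RKRK_table (n m : int) : seq (seq A) :=
  let: (a, b, c, d) := (k 0 0, k 0 1, k 1 0, k 1 1) in
  [:: [:: self_coef q a n m; mixed_coef1 q false a b n m;
          mixed_coef2 q false a b n m; q^-1 *: self_coef q b n m];
      [:: - mixed_coef1 q true a c n m; cross_coef1 q a d c b n m;
          cross_coef2 q a d c b n m; - mixed_coef2 q true d b n m];
      [:: - mixed_coef2 q true a c n m; cross_coef2 q d a b c n m;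
          cross_coef1 q d a b c n m; - mixed_coef1 q true d b n m];
      [:: q^-1 *: self_coef q c n m; mixed_coef2 q false d c n m;
          mixed_coef1 q false d c n m; self_coef q d n m]].

Lemma RKRK_diffE i j n m :
  RKRK_diff i j n m = nth 0 (nth [::] (RKRK_table n m) i) j.
Proof.
have coN x n' m' : co n' m' (- x) = - co n' m' x.
  by rewrite -scaleN1r coZ scaleN1r.
rewrite /RKRK_diff RKRK_lmxE RKRK_rmxE.
case: i => [[|[|[|[|//]]]] Hi]; case: j => [[|[|[|[|//]]]] Hj] /=;
  rewrite ?(mulrBl, mulrBr, =^~ scalerAl, =^~ scalerAr);
  rewrite ?(coD, coN, coZ, co_wM, co_wVM, co_Mw, co_MwV, co_UV, co_VU);
  rewrite /self_coef /mixed_coef1 /mixed_coef2 /cross_coef1 /cross_coef2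
    /acoef /bcoef /ccoef /omul /=.
all: by nc_ring A; ring.
Qed.

End RKRK.

(** * Series of even and of odd exponents *)

(* The exponents of u in a series in U^-1 and in u times such a series.       *)
Definition ee (i : int) : int := - (2 * i).
Definition oo (i : int) : int := 1 - 2 * i.

Lemma ee_sub1 i : ee i - 1 = oo (i + 1). Proof. rewrite /ee /oo; lia. Qed.
Lemma ee_add1 i : ee i + 1 = oo i. Proof. rewrite /ee /oo; lia. Qed.
Lemma oo_sub1 i : oo i - 1 = ee i. Proof. rewrite /ee /oo; lia. Qed.
Lemma oo_add1 i : oo i + 1 = ee (i - 1). Proof. rewrite /ee /oo; lia. Qed.
Definition parityE := (ee_sub1, ee_add1, oo_sub1, oo_add1).

Variant parity_spec : int -> Prop :=
| ParityEven i : parity_spec (ee i)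
| ParityOdd i : parity_spec (oo i).

Lemma parityP m : parity_spec m.
Proof.
have [e|e] : (exists i, m = ee i) \/ (exists i, m = oo i).
  have := divz_eq m 2; have := ltz_pmod m (isT : 0 < 2%:Z).
  have := modz_ge0 m (isT : 2%:Z != 0).
  move: (m %/ 2)%Z (m %% 2)%Z => d r ? ? ?.
  have [r0|r1] : r = 0 \/ r = 1 by lia.
    by left; exists (- d); rewrite /ee; lia.
  by right; exists (- d); rewrite /oo; lia.
  by case: e => i ->; exact: ParityEven.
by case: e => i ->; exact: ParityOdd.
Qed.

Section Parity.
Variables (F : fieldType) (q s : F) (A : algType F) (I : A -> Prop).
Hypotheses (q0 : q != 0) (s0 : s != 0) (idI : two_sided_ideal I).

Definition odd_series (a : F) (x : nat -> A) (X : int -> A) : Prop :=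
  (forall i, X (oo i) = (a * s ^ i) *: zext x (i - 1)) /\
  (forall i, X (ee i) = 0).
Definition even_series (b : F) (y : nat -> A) (Y : int -> A) : Prop :=
  (forall i, Y (ee i) = (b * s ^ i) *: zext y i) /\ (forall i, Y (oo i) = 0).

Lemma exps_add1 i : s ^ (i + 1) = s ^ i * s.
Proof. by rewrite expfzDr // expr1z. Qed.
Lemma exps_sub1 i : s ^ (i - 1) = s ^ i / s.
Proof. by rewrite expfzDr // exprN1. Qed.
Let expsE := (exps_add1, exps_sub1).
Let exps0 i : s ^ i != 0. Proof. exact: expfz_neq0. Qed.

Lemma self_odd (a : F) x X : a != 0 -> odd_series a x X ->
  (forall n m, I (self_coef q X n m)) <-> (forall i j, I (self_rel q x i j)).
Proof.
move=> a0 [Xo Xe].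
have E i j : self_coef q X (ee j) (ee i) =
    (a ^+ 2 * (s ^ i * s ^ j * s)) *: self_rel q x i j.
  rewrite /self_coef /acoef /omul !parityE !Xo !addrK !expsE /self_rel /comm.
  by nc_ring A; field; rewrite ?q0.
split=> H.
  move=> i j; apply: (idealZE idI (c := a ^+ 2 * (s ^ i * s ^ j * s))).
    by rewrite !mulf_neq0 ?expf_neq0.
  by rewrite -E.
move=> n m; case: (parityP n) => j; case: (parityP m) => i.
- by rewrite E; apply: (idealZ idI).
all: apply: (ideal_zero idI); rewrite /self_coef /acoef /omul !parityE ?Xe;
  by nc_ring A.
Qed.

Lemma self_even (b : F) y Y : b != 0 -> even_series b y Y ->
  (forall n m, I (self_coef q Y n m)) <-> (forall i j, I (self_rel q y i j)).
Proof.
move=> b0 [Ye Yo].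
have E i j : self_coef q Y (oo j) (oo i) =
    (b ^+ 2 * (s ^ i * s ^ j / s)) *: self_rel q y i j.
  rewrite /self_coef /acoef /omul !parityE !Ye !expsE /self_rel /comm.
  by nc_ring A; field; rewrite ?q0.
split=> H.
  move=> i j; apply: (idealZE idI (c := b ^+ 2 * (s ^ i * s ^ j / s))).
    by rewrite !mulf_neq0 ?expf_neq0 ?invr_eq0.
  by rewrite -E.
move=> n m; case: (parityP n) => j; case: (parityP m) => i.
4: by rewrite E; apply: (idealZ idI).
all: apply: (ideal_zero idI); rewrite /self_coef /acoef /omul !parityE ?Yo;
  by nc_ring A.
Qed.

Section MixedParity.
Variables (o : bool) (a b : F) (x y : nat -> A) (X Y : int -> A).
Hypotheses (a0 : a != 0) (b0 : b != 0).
Hypotheses (Xx : odd_series a x X) (Yy : even_series b y Y).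

Lemma mixed_parity1 : (forall n m, I (mixed_coef1 q o X Y n m)) <->
  (forall i j, I (mixed_rel1 q o x y i j)).
Proof.
have [[Xo Xe] [Ye Yo]] := (Xx, Yy).
have E i j : mixed_coef1 q o X Y (oo j) (ee i) =
    (a * b * (s ^ i * s ^ j)) *: mixed_rel1 q o x y i j.
  rewrite /mixed_coef1 /acoef /bcoef /ccoef /omul.
  rewrite !parityE !Xo !Ye !addrK !expsE.
  by rewrite /mixed_rel1 /omul; case: o => /=; nc_ring A; field; rewrite ?q0.
split=> H.
  move=> i j; apply: (idealZE idI (c := a * b * (s ^ i * s ^ j))).
    by rewrite !mulf_neq0.
  by rewrite -E.
move=> n m; case: (parityP n) => j; case: (parityP m) => i.
3: by rewrite E; apply: (idealZ idI).
all: apply: (ideal_zero idI).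
all: rewrite /mixed_coef1 /acoef /bcoef /ccoef /omul !parityE ?Xe ?Yo.
all: by case: o => /=; nc_ring A.
Qed.

Lemma mixed_parity2 : (forall n m, I (mixed_coef2 q o X Y n m)) <->
  (forall i j, I (mixed_rel2 q o x y i j)).
Proof.
have [[Xo Xe] [Ye Yo]] := (Xx, Yy).
have E i j : mixed_coef2 q o X Y (ee j) (oo i) =
    (a * b * (s ^ i * s ^ j)) *: mixed_rel2 q o x y i j.
  rewrite /mixed_coef2 /acoef /bcoef /ccoef /omul.
  rewrite !parityE !Xo !Ye !addrK !expsE.
  by rewrite /mixed_rel2 /omul; case: o => /=; nc_ring A; field; rewrite ?q0.
split=> H.
  move=> i j; apply: (idealZE idI (c := a * b * (s ^ i * s ^ j))).
    by rewrite !mulf_neq0.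
  by rewrite -E.
move=> n m; case: (parityP n) => j; case: (parityP m) => i.
2: by rewrite E; apply: (idealZ idI).
all: apply: (ideal_zero idI).
all: rewrite /mixed_coef2 /acoef /bcoef /ccoef /omul !parityE ?Xe ?Yo.
all: by case: o => /=; nc_ring A.
Qed.

End MixedParity.

Section CrossParity.
Variables (b b' : F) (p m z t : nat -> A) (P M Z T : int -> A).
Hypotheses (qs : q * s = q + q^-1) (bb : b * b' * rhobar q = 1).
Hypotheses (Pp : odd_series q p P) (Mm : odd_series q m M).
Hypotheses (Zz : even_series b z Z) (Tt : even_series b' t T).

Let bb0 : b * b' != 0.
Proof.
apply/negP => /eqP b0; move: bb; rewrite b0 mul0r => /esym/eqP.
by rewrite oner_eq0.
Qed.
Let rhoE : rhobar q = (b * b')^-1.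
Proof. by rewrite -[RHS]mul1r -bb mulrAC divff // mul1r. Qed.

Lemma cross_parity1 : (forall n k, I (cross_coef1 q P M Z T n k)) <->
  (forall i j, I (cross_rel1 q p m z t i j)).
Proof.
have [[Po Pe] [Mo Me]] := (Pp, Mm); have [[Ze Zo] [Te To]] := (Zz, Tt).
have E i j : cross_coef1 q P M Z T (ee j) (ee i) =
    (b * b' * (s ^ i * s ^ j)) *: cross_rel1 q p m z t i j.
  rewrite /cross_coef1 /bcoef /ccoef /omul.
  rewrite !parityE !Po !Mo !Ze !Te !addrK !expsE.
  rewrite /cross_rel1 /comm -qs rhoE.
  move: bb0; rewrite mulf_eq0 negb_or => /andP[b0 b'0].
  by nc_ring A; field; rewrite ?q0 ?s0 ?b0 ?b'0.
split=> H.
  move=> i j; apply: (idealZE idI (c := b * b' * (s ^ i * s ^ j))).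
    by rewrite mulf_neq0 // !mulf_neq0.
  by rewrite -E.
move=> n k; case: (parityP n) => j; case: (parityP k) => i.
1: by rewrite E; apply: (idealZ idI).
all: apply: (ideal_zero idI).
all: rewrite /cross_coef1 /bcoef /ccoef /omul !parityE ?Pe ?Me ?Zo ?To.
all: by nc_ring A.
Qed.

Lemma cross_parity2 : (forall n k, I (cross_coef2 q P M Z T n k)) <->
  (forall i j, I (cross_rel2 q p m z t i j)).
Proof.
have [[Po Pe] [Mo Me]] := (Pp, Mm); have [[Ze Zo] [Te To]] := (Zz, Tt).
have E i j : cross_coef2 q P M Z T (oo j) (oo i) =
    (b * b' * (s ^ i * s ^ j / s)) *: cross_rel2 q p m z t i j.
  rewrite /cross_coef2 /bcoef /ccoef /omul !parityE !Po !Mo !Ze !Te !expsE.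
  rewrite /cross_rel2 /comm -qs rhoE.
  move: bb0; rewrite mulf_eq0 negb_or => /andP[b0 b'0].
  by nc_ring A; field; rewrite ?q0 ?s0 ?b0 ?b'0.
split=> H.
  move=> i j; apply: (idealZE idI (c := b * b' * (s ^ i * s ^ j / s))).
    by rewrite mulf_neq0 // !mulf_neq0 ?invr_eq0.
  by rewrite -E.
move=> n k; case: (parityP n) => j; case: (parityP k) => i.
4: by rewrite E; apply: (idealZ idI).
all: apply: (ideal_zero idI).
all: rewrite /cross_coef2 /bcoef /ccoef /omul !parityE ?Pe ?Me ?Zo ?To.
all: by nc_ring A.
Qed.

End CrossParity.
End Parity.

Section Convolution.
Variables (F : fieldType) (A : algType F).
Implicit Types f g : laurent A.

Definition supported (a : int) f : Prop :=
  forall n, (forall k : nat, n != a - 2 * k%:Z) -> f n = 0.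

Lemma supported_mul a b f g :
  supported a f -> supported b g -> supported (a + b) (f * g).
Proof.
move=> fa gb n nab; rewrite lcoefM fsbig1 // => i _.
have [[k ik]|ik] := EM (exists k : nat, i = a - 2 * k%:Z); last first.
  by rewrite fa ?mul0r // => k; apply/eqP => ?; apply: ik; exists k.
rewrite [g _]gb ?mulr0 // => l; apply/eqP => nil.
by move: (nab (k + l)%N) => /eqP; apply; lia.
Qed.

Lemma supported_mulE a b f g (N : nat) :
    supported a f -> supported b g ->
  (f * g) (a + b - 2 * N%:Z) =
  \sum_(0 <= k < N.+1) f (a - 2 * k%:Z) * g (b - 2 * (N - k)%N%:Z).
Proof.
move=> fa gb; rewrite lcoefM.
pose r := [seq a - 2 * k%:Z | k <- iota 0 N.+1].
rewrite -(fsbig_widen [set` r]%classic setT) //=; last first.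
  move=> i [_ /= /negP ir].
  have [[k ik]|ik] := EM (exists k : nat, i = a - 2 * k%:Z); last first.
    by rewrite fa ?mul0r // => k; apply/eqP => ?; apply: ik; exists k.
  rewrite [g _]gb ?mulr0 // => l; apply/eqP => nil; case/negP: ir.
  by apply/mapP; exists k => //; rewrite mem_iota /=; lia.
rewrite -fsbig_seq; last first.
  by rewrite map_inj_uniq ?iota_uniq // => k l /= ?; lia.
rewrite /r big_map -[iota 0 _]/(index_iota 0 N.+1).
by apply: eq_big_nat => k /andP[_ kN]; congr (_ * g _); lia.
Qed.

End Convolution.

Section SeriesProducts.
Variables (F : fieldType) (q s : F) (A : algType F).
Hypotheses (q0 : q != 0) (s0 : s != 0).
Implicit Types X Y : laurent A.

Lemma odd_series_supported a x X : odd_series s a x X -> supported (-1) X.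
Proof.
move=> [Xo Xe] n nk; case: (parityP n) nk => i nk; first exact: Xe.
rewrite Xo; case: i nk => [[|k]|k] nk; rewrite ?zextE ?scaler0 //.
by move: (nk k); rewrite (_ : oo _ = - 1 - 2 * k%:Z) ?eqxx // /oo; lia.
Qed.

Lemma even_series_supported b y Y : even_series s b y Y -> supported 0 Y.
Proof.
move=> [Ye Yo] n nk; case: (parityP n) nk => i nk; last exact: Yo.
rewrite Ye; case: i nk => [k|k] nk; rewrite ?zextE ?scaler0 //.
by move: (nk k); rewrite (_ : ee _ = 0 - 2 * k%:Z) ?eqxx // /ee; lia.
Qed.

Lemma lsubst_supported c a X : supported a X -> supported a (lsubst c X).
Proof. by move=> Xa n /Xa /= ->; rewrite scaler0. Qed.

Lemma odd_series_mulE a a' x x' X X' N :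
    odd_series s a x X -> odd_series s a' x' X' ->
  (X * lsubst q X') (ee N.+1) =
  (a * a' * s ^+ N.+2 * q^-1 * q ^- N) *:
    wsum (fun k => q ^ (2 * k%:Z - N%:Z)) (fun k => x k * x' (N - k)%N) N.+1.
Proof.
move=> Xx Xx'; have sX := odd_series_supported Xx.
have sX' := lsubst_supported q (odd_series_supported Xx').
have -> : ee N.+1 = - 1 + - 1 - 2 * N%:Z by rewrite /ee; lia.
rewrite (supported_mulE _ sX sX') /wsum scaler_sumr.
apply: eq_big_nat => k /andP[_ kN].
have ooE (l : nat) : - 1 - 2 * l%:Z = oo l.+1 by rewrite /oo; lia.
rewrite /= !ooE; case: Xx Xx' => [-> _] [-> _]; rewrite !zextE.
rewrite -!scalerAl -!scalerAr !scalerA; congr (_ *: _).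
have -> : oo (N - k).+1 = - 1 + (- N%:Z + (2 * k%:Z - N%:Z)).
  by rewrite /oo; lia.
rewrite !expfzDr // exprN1 -!exprz_inv !exprnP.
have -> : s ^ N.+2 = s ^ k.+1 * s ^ (N - k).+1.
  by rewrite -expfzDr //; congr (_ ^ _); lia.
have -> : q^-1 ^ N = (q ^+ N)^-1 by rewrite -exprVn.
by rewrite -!exprnP; field; rewrite ?expf_neq0.
Qed.

Lemma even_series_mulE b b' y y' Y Y' (N : nat) :
    even_series s b y Y -> even_series s b' y' Y' ->
  (Y * lsubst q Y') (ee N) =
  (b * b' * s ^+ N * q ^- N) *:
    wsum (fun k => q ^ (2 * k%:Z - N%:Z)) (fun k => y k * y' (N - k)%N) N.+1.
Proof.
move=> Yy Yy'; have sY := even_series_supported Yy.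
have sY' := lsubst_supported q (even_series_supported Yy').
have -> : ee N = 0 + 0 - 2 * N%:Z by rewrite /ee; lia.
rewrite (supported_mulE _ sY sY') /wsum scaler_sumr.
apply: eq_big_nat => k /andP[_ kN].
have eeE (l : nat) : 0 - 2 * l%:Z = ee l by rewrite /ee; lia.
rewrite /= !eeE; case: Yy Yy' => [-> _] [-> _]; rewrite !zextE.
rewrite -!scalerAl -!scalerAr !scalerA; congr (_ *: _).
have -> : ee (N - k)%N = - N%:Z + (2 * k%:Z - N%:Z) by rewrite /ee; lia.
rewrite !expfzDr // -!exprz_inv !exprnP.
have -> : s ^ N = s ^ k * s ^ (N - k)%N.
  by rewrite -expfzDr //; congr (_ ^ _); lia.
have -> : q^-1 ^ N = (q ^+ N)^-1 by rewrite -exprVn.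
by rewrite -!exprnP; field; rewrite ?expf_neq0.
Qed.

Lemma odd_series_mul0 a a' x x' X X' n :
    odd_series s a x X -> odd_series s a' x' X' ->
  (forall N : nat, n != ee N.+1) -> (X * lsubst q X') n = 0.
Proof.
move=> Xx Xx' nN; apply: (supported_mul (odd_series_supported Xx)
  (lsubst_supported q (odd_series_supported Xx'))) => N.
by rewrite (_ : - 1 + - 1 - _ = ee N.+1) // /ee; lia.
Qed.

Lemma even_series_mul0 b b' y y' Y Y' n :
    even_series s b y Y -> even_series s b' y' Y' ->
  (forall N : nat, n != ee N) -> (Y * lsubst q Y') n = 0.
Proof.
move=> Yy Yy' nN; apply: (supported_mul (even_series_supported Yy)
  (lsubst_supported q (even_series_supported Yy'))) => N.
by rewrite (_ : 0 + 0 - _ = ee N) // /ee; lia.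
Qed.

End SeriesProducts.

Section QuantumTrace.
Variables (F : fieldType) (q : F) (B : algType F).
Hypothesis c0 : q - q^-1 != 0.

Lemma Pminus_mx4 : let h : B := 2^-1%:A in
  Pminus q B = mx4 [:: [:: 0; 0; 0; 0]; [:: 0; h; - h; 0];
                       [:: 0; - h; h; 0]; [:: 0; 0; 0; 0]].
Proof.
apply/matrixP => i j; rewrite /Pminus /Pmx !mxE.
have c1 : (q - q^-1)^-1%:A * (q *: 1 - q^-1 *: 1) = 1 :> B.
  by rewrite -scalerBl mulr_algl scalerA mulVf // scale1r.
have c2 : (q - q^-1)^-1%:A * (q - q^-1)%:A = 1 :> B.
  by rewrite mulr_algl scalerA mulVf // scale1r.
case: i => [[|[|[|[|//]]]] Hi]; case: j => [[|[|[|[|//]]]] Hj] /=;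
  rewrite ?c1 ?c2 ?subrr ?mulr0 ?subr0 ?subrr ?mulr0 ?sub0r ?mulrN ?mulr1 //.
Qed.

Lemma Pminus_trace (U V : 'M[B]_2) :
  \tr (Pminus q B *m (U *t 1%:M *m R0mx q B *m (1%:M *t V))) =
  2^-1 *: (q^-1 *: (U 0 0 * V 1 1) - U 1 0 * V 0 1
           + (q^-1 *: (U 1 1 * V 0 0) - U 0 1 * V 1 0)).
Proof.
rewrite KRK_mx4 Pminus_mx4 /mxtrace !big_ord_recl big_ord0 !mx4M /=.
by nc_ring B; ring.
Qed.

End QuantumTrace.

Section LaurentEntries.
Variables (F : fieldType) (q : F) (A : algType F) (K : 'M[laurent A]_2).
Local Notation L2 := (laurent (laurent A)).
Local Notation Ku := (map_mx (@in_u F A) K).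
Local Notation Kv := (map_mx (@in_v F A) K).

Lemma RKRK_laurentE (i j : 'I_(2 * 2)) (n m : int) :
  RKRK_lmx q (u_v A) (v_u A) Ku Kv i j n m
  - RKRK_rmx q (u_v A) (v_u A) Ku Kv i j n m
  = nth 0 (nth [::] (RKRK_table q (fun a b => lcoef (K a b)) n m) i) j.
Proof.
have KuE a b : Ku a b = in_u (K a b) := mxE _ _ _ _.
have KvE a b : Kv a b = in_v (K a b) := mxE _ _ _ _.
have co_UV n' m' a b c d : (Ku a b * Kv c d) n' m' = K a b m' * K c d n'.
  by rewrite KuE KvE in_uv.
have co_VU n' m' a b c d : (Kv c d * Ku a b) n' m' = K c d n' * K a b m'.
  by rewrite KuE KvE in_vu.
exact: (@RKRK_diffE F q A L2 (u_v A) (v_u A) _ _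
  (fun a b => lcoef (K a b)) (fun n m (x : L2) => x n m)
  (fun n m x y => lcoefD2 x y n m) (fun n m c x => lcoefZ2 c x n m)
  (fun n m x => u_vM x n m) (fun n m x => v_uM x n m)
  (fun n m x => Mu_v x n m) (fun n m x => Mv_u x n m) co_UV co_VU).
Qed.

End LaurentEntries.

Section Equivalence.
Variables (F : fieldType) (q kp km : F) (A : algType F) (g : gen -> A).
Variable I : A -> Prop.
Hypotheses (q0 : q != 0) (q1 : q ^+ 2 - 1 != 0) (q2 : q ^+ 2 + 1 != 0).
Hypotheses (two0 : 2 != 0 :> F) (idI : two_sided_ideal I).
Hypothesis hk : rhobar q = kp * km * (q + q^-1) ^+ 2.

Local Notation rho := (rhobar q).
Local Notation qp := (q + q^-1).
Local Notation K := (Kmx q kp km g).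
Local Notation s := ((q + q^-1) / q).

Let qp0 : qp != 0 := qp_neq0 q0 q2.
Let qm0 : q - q^-1 != 0 := qm_neq0 q0 q1.
Let rho0 : rho != 0 := rhobar_neq0 q0 q1 q2.
Let s0 : s != 0. Proof. by rewrite mulf_neq0 ?invr_eq0. Qed.
Let kpm0 : kp != 0 /\ km != 0.
Proof. by move: rho0; rewrite hk !mulf_eq0 !negb_or => /andP[/andP[]]. Qed.

Definition shiftc (y : nat -> A) (k : nat) : A :=
  if k is k'.+1 then y k' else (rho / (q - q^-1))%:A.

Local Notation p := (fun k => g (gYp k)).
Local Notation m := (fun k => g (gYm k)).
Local Notation z := (shiftc (fun k => g (gZ k))).
Local Notation t := (shiftc (fun k => g (gZt k))).

Lemma genfun_ee (y : nat -> A) i : genfun q y (ee i) = s ^ i *: zext y (i - 1).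
Proof.
case: i => [[|k]|k]; rewrite ?zextE.
- by rewrite scaler0.
- by rewrite -genfunE; congr (genfun q y _); rewrite /ee; lia.
by rewrite scaler0 (_ : ee (Negz k) = (2 * k.+1)%N%:Z) // /ee; lia.
Qed.

Lemma genfun_oo (y : nat -> A) i : genfun q y (oo i) = 0.
Proof.
case: i => [[|k]|k].
- by rewrite /oo.
- have -> : oo k.+1 = Negz (2 * k) by rewrite /oo; lia.
  by rewrite /= oddM.
by rewrite (_ : oo (Negz k) = (2 * k.+1).+1%N%:Z) // /oo; lia.
Qed.

Lemma odd_entry (y : nat -> A) :
  odd_series s q y (q *: (lmono 1 1 : laurent A) * genfun q y).
Proof.
split=> i; rewrite -scalerAl lcoefZ lmonoM mul1r parityE.
  by rewrite genfun_ee scalerA.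
by rewrite genfun_oo scaler0.
Qed.

Lemma even_entry (y : nat -> A) b c : b * (rho / (q - q^-1)) = c ->
  even_series s b (shiftc y) (b *: genfun q y + c%:A).
Proof.
move=> bc; split=> i; rewrite lcoefD !lcoefZ lcoef1.
  rewrite genfun_ee; case: i => [[|k]|k]; rewrite ?zextE.
  - rewrite (_ : (ee _ == 0) = true) //.
    by rewrite !scaler0 add0r /= expr0z mulr1 scalerA bc.
  - by rewrite (_ : (ee _ == 0) = false) ?scaler0 ?addr0 ?scalerA // /ee; lia.
  by rewrite (_ : (ee _ == 0) = false) ?scaler0 ?addr0 // /ee; lia.
by rewrite genfun_oo (_ : (oo i == 0) = false) ?scaler0 ?addr0 // /oo; lia.
Qed.

Lemma K00_series : odd_series s q p (K 0 0).
Proof. by rewrite mxE; exact: odd_entry. Qed.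
Lemma K11_series : odd_series s q m (K 1 1).
Proof. by rewrite mxE; exact: odd_entry. Qed.
Lemma K01_series : even_series s (km * qp)^-1 t (K 0 1).
Proof.
have [kp0 km0] := kpm0; rewrite mxE; apply: even_entry.
by rewrite hk; field; rewrite ?q0 ?q1 ?q2 ?km0.
Qed.
Lemma K10_series : even_series s (kp * qp)^-1 z (K 1 0).
Proof.
have [kp0 km0] := kpm0; rewrite mxE; apply: even_entry.
by rewrite hk; field; rewrite ?q0 ?q1 ?q2 ?kp0.
Qed.

Lemma FM_diffE i j n k :
  FM_lhs q kp km g i j n k - FM_rhs q kp km g i j n k =
  nth 0 (nth [::] (RKRK_table q (fun a b => lcoef (K a b)) n k) i) j.
Proof. by rewrite -RKRK_laurentE. Qed.

Let kp0 : (kp * qp)^-1 != 0.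
Proof. by have [? _] := kpm0; rewrite invr_eq0 mulf_neq0. Qed.
Let km0 : (km * qp)^-1 != 0.
Proof. by have [_ ?] := kpm0; rewrite invr_eq0 mulf_neq0. Qed.
Let qs : q * s = qp. Proof. by field; rewrite ?q0. Qed.
Let kpm : (kp * qp)^-1 * (km * qp)^-1 * rho = 1.
Proof.
have [kpn kmn] := kpm0.
rewrite hk -invfM; have -> : kp * km * qp ^+ 2 = kp * qp * (km * qp) by ring.
by rewrite mulVf // !mulf_neq0.
Qed.
Let kmp : (km * qp)^-1 * (kp * qp)^-1 * rho = 1.
Proof. by rewrite [_^-1 * _^-1]mulrC. Qed.
Lemma RKRK_modE :
  (forall i j n k, I (FM_lhs q kp km g i j n k - FM_rhs q kp km g i j n k)) <->
  RKRK_mod q I p m z t.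
Proof.
pose o1 := Ordinal (isT : (1 < 2 * 2)%N).
pose o2 := Ordinal (isT : (2 < 2 * 2)%N).
pose o3 := Ordinal (isT : (3 < 2 * 2)%N).
have NI x : I (- x) -> I x by move=> /(idealN idI); rewrite opprK.
have qV : q^-1 != 0 by rewrite invr_eq0.
have ZI x : I (q^-1 *: x) -> I x := idealZE idI qV.
split=> [H|].
  have {}H (i j : 'I_(2 * 2)) n k :
      I (nth 0 (nth [::] (RKRK_table q (fun a b => lcoef (K a b)) n k) i) j).
    exact: (ideal_eq (H i j n k) (esym (FM_diffE i j n k))).
  split.
  - apply/(self_odd q0 s0 idI q0 K00_series) => n k.
    exact: (H 0 0).
  - apply/(self_odd q0 s0 idI q0 K11_series) => n k.
    exact: (H o3 o3).
  - apply/(self_even q0 s0 idI kp0 K10_series) => n k.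
    by apply: ZI; exact: (H o3 0).
  - apply/(self_even q0 s0 idI km0 K01_series) => n k.
    by apply: ZI; exact: (H 0 o3).
  - move=> i j; split; move: i j.
      apply/(mixed_parity1 q0 s0 idI false q0 km0
        K00_series K01_series) => n k.
      exact: (H 0 o1).
    apply/(mixed_parity2 q0 s0 idI false q0 km0
      K00_series K01_series) => n k.
    exact: (H 0 o2).
  - move=> i j; split; move: i j.
      apply/(mixed_parity1 q0 s0 idI false q0 kp0
        K11_series K10_series) => n k.
      exact: (H o3 o2).
    apply/(mixed_parity2 q0 s0 idI false q0 kp0
      K11_series K10_series) => n k.
    exact: (H o3 o1).
  - move=> i j; split; move: i j.
      apply/(mixed_parity1 q0 s0 idI true q0 kp0
        K00_series K10_series) => n k.
      by apply: NI; exact: (H o1 0).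
    apply/(mixed_parity2 q0 s0 idI true q0 kp0
      K00_series K10_series) => n k.
    by apply: NI; exact: (H o2 0).
  - move=> i j; split; move: i j.
      apply/(mixed_parity1 q0 s0 idI true q0 km0
        K11_series K01_series) => n k.
      by apply: NI; exact: (H o2 o3).
    apply/(mixed_parity2 q0 s0 idI true q0 km0
      K11_series K01_series) => n k.
    by apply: NI; exact: (H o1 o3).
  - apply/(cross_parity1 q0 s0 idI qs kpm
      K00_series K11_series K10_series K01_series) => n k.
    exact: (H o1 o1).
  - apply/(cross_parity1 q0 s0 idI qs kmp
      K11_series K00_series K01_series K10_series) => n k.
    exact: (H o2 o2).
  - apply/(cross_parity2 q0 s0 idI qs kpm
      K00_series K11_series K10_series K01_series) => n k.
    exact: (H o1 o2).
  - apply/(cross_parity2 q0 s0 idI qs kmp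
      K11_series K00_series K01_series K10_series) => n k.
    exact: (H o2 o1).
case=> pp mm zz tt pt mz pz mt pm1 mp1 pm2 mp2 i j n k.
apply: (ideal_eq _ (FM_diffE i j n k)); move: n k.
have N := idealN idI; have Z := idealZ idI.
case: i => [[|[|[|[|//]]]] Hi]; case: j => [[|[|[|[|//]]]] Hj] n k /=.
- exact: ((self_odd q0 s0 idI q0 K00_series).2 pp).
- exact: ((mixed_parity1 q0 s0 idI false q0 km0 K00_series K01_series).2
    (fun i j => (pt i j).1)).
- exact: ((mixed_parity2 q0 s0 idI false q0 km0 K00_series K01_series).2
    (fun i j => (pt i j).2)).
- exact: Z ((self_even q0 s0 idI km0 K01_series).2 tt _ _).
- exact: N ((mixed_parity1 q0 s0 idI true q0 kp0 K00_series K10_series).2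
    (fun i j => (pz i j).1) _ _).
- exact: ((cross_parity1 q0 s0 idI qs kpm
    K00_series K11_series K10_series K01_series).2 pm1).
- exact: ((cross_parity2 q0 s0 idI qs kpm
    K00_series K11_series K10_series K01_series).2 pm2).
- exact: N ((mixed_parity2 q0 s0 idI true q0 km0 K11_series K01_series).2
    (fun i j => (mt i j).2) _ _).
- exact: N ((mixed_parity2 q0 s0 idI true q0 kp0 K00_series K10_series).2
    (fun i j => (pz i j).2) _ _).
- exact: ((cross_parity2 q0 s0 idI qs kmp
    K11_series K00_series K01_series K10_series).2 mp2).
- exact: ((cross_parity1 q0 s0 idI qs kmp
    K11_series K00_series K01_series K10_series).2 mp1).
- exact: N ((mixed_parity1 q0 s0 idI true q0 km0 K11_series K01_series).2
    (fun i j => (mt i j).1) _ _).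
- exact: Z ((self_even q0 s0 idI kp0 K10_series).2 zz _ _).
- exact: ((mixed_parity2 q0 s0 idI false q0 kp0 K11_series K10_series).2
    (fun i j => (mz i j).2)).
- exact: ((mixed_parity1 q0 s0 idI false q0 kp0 K11_series K10_series).2
    (fun i j => (mz i j).1)).
exact: ((self_odd q0 s0 idI q0 K11_series).2 mm).
Qed.

Lemma FM_qdetE n : FM_qdet q kp km g n = 2^-1 *:
  (q^-1 *: (K 0 0 * lsubst q (K 1 1)) n - (K 1 0 * lsubst q (K 0 1)) n
   + (q^-1 *: (K 1 1 * lsubst q (K 0 0)) n - (K 0 1 * lsubst q (K 1 0)) n)).
Proof.
have E : FM_qdet q kp km g = _ := Pminus_trace qm0 K (map_mx (lsubst q) K).
have sE a b : map_mx (lsubst q) K a b = lsubst q (K a b) := mxE _ _ _ _.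
by rewrite E !sE.
Qed.

Local Notation trace_const :=
  ((- (rho / (q - q^-1) ^+ 2))%:A : laurent A).

Lemma qdet_succ (N : nat) :
  FM_qdet q kp km g (ee N.+1) - trace_const (ee N.+1) =
  (2^-1 * ((kp * qp)^-1 * (km * qp)^-1 * s ^+ N.+1 * q ^- N.+1)) *:
    (det_rel q p m z t N + det_rel q m p t z N).
Proof.
have [kpn kmn] := kpm0.
rewrite FM_qdetE (odd_series_mulE q0 s0 N K00_series K11_series).
rewrite (odd_series_mulE q0 s0 N K11_series K00_series).
rewrite (even_series_mulE q0 s0 N.+1 K10_series K01_series).
rewrite (even_series_mulE q0 s0 N.+1 K01_series K10_series).
have -> : (fun k : nat => q ^ (2 * k%:Z - N.+1%:Z)) =
          (fun k : nat => q ^ (2 * k%:Z - N%:Z - 1)).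
  by apply/funext => k; rewrite intS [1 + _]addrC opprD addrA.
have -> : trace_const (ee N.+1) = 0.
  by rewrite lcoefZ lcoef1 (_ : (ee _ == 0) = false) ?scaler0 // /ee; lia.
rewrite /det_rel hk !exprSr.
by nc_ring A; field; rewrite ?expf_neq0 ?q0 ?q2 ?kpn ?kmn ?two0.
Qed.

Lemma qdet_other n : (forall N : nat, n != ee N.+1) ->
  FM_qdet q kp km g n - trace_const n = 0.
Proof.
move=> nN; have [kpn kmn] := kpm0.
rewrite FM_qdetE (odd_series_mul0 q0 s0 K00_series K11_series) //.
rewrite (odd_series_mul0 q0 s0 K11_series K00_series) //.
case: (eqVneq n (ee 0%N)) => [->|n0].
  rewrite (even_series_mulE q0 s0 0 K10_series K01_series).
  rewrite (even_series_mulE q0 s0 0 K01_series K10_series).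
  rewrite lcoefZ lcoef1 /wsum !big_nat1 /= !expr0z mulr1n hk.
  by nc_ring A; field; rewrite ?oner_neq0 ?q0 ?q1 ?q2 ?kpn ?kmn ?two0.
have nN' (N : nat) : n != ee N by case: N => [|N].
rewrite (even_series_mul0 q0 s0 K10_series K01_series) //.
rewrite (even_series_mul0 q0 s0 K01_series K10_series) //.
rewrite lcoefZ lcoef1 (negPf (n0 : n != 0)) mulr0n.
by nc_ring A; ring.
Qed.

Lemma qdet_modE : RKRK_mod q I p m z t ->
  (forall n, I (FM_qdet q kp km g n - trace_const n)) <->
  (forall n, I (det_rel q p m z t n)).
Proof.
move=> rel.
have sw n := det_rel_swap q0 q1 q2 idI n (RKRK_pm1 rel) (RKRK_pm2 rel).
have [kpn kmn] := kpm0.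
split=> H.
  move=> n.
  have c0 : 2^-1 * ((kp * qp)^-1 * (km * qp)^-1 * s ^+ n.+1 * q ^- n.+1) != 0.
    by rewrite mulf_neq0 ?invr_eq0 // !mulf_neq0 // ?invr_eq0 expf_neq0.
  have := H (ee n.+1); rewrite qdet_succ => /(idealZE idI c0) sum.
  apply: (idealZE idI two0); apply: (ideal_eq (idealD idI sum (sw n))).
  by nc_ring A; ring.
move=> n; have [[N ->]|nN] := EM (exists N : nat, n = ee N.+1).
  rewrite qdet_succ; apply: (idealZ idI).
  apply: (ideal_eq (idealB idI (idealZ idI 2 (H N)) (sw N))).
  by nc_ring A; ring.
apply: (ideal_zero idI); apply: qdet_other => N.
by apply/eqP => nE; apply: nN; exists N.
Qed.

End Equivalence.

(** * The two presentations *)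

Section IdealGen.
Variables (F : fieldType) (X : choiceType).
Local Notation Fr := (freealg F X).
Implicit Types rel : Fr -> Fr -> Prop.

Lemma ideal_gen_two_sided rel : two_sided_ideal (ideal_gen rel).
Proof.
split=> [|x y|a x b Ix]; [exact: ideal_gen0 | exact: ideal_genD |].
elim: Ix => [|x1 x2 _ I1 _ I2|c d l r lr].
- by rewrite mulr0 mul0r; exact: ideal_gen0.
- by rewrite mulrDr mulrDl; exact: ideal_genD.
have -> : a * (c * (l - r) * d) * b = a * c * (l - r) * (d * b).
  by move: (l - r) => e; rewrite !mulrA.
exact: ideal_gen_rel.
Qed.

Lemma ideal_gen_le rel1 rel2 x :
    (forall l r, rel1 l r -> ideal_gen rel2 (l - r)) ->
  ideal_gen rel1 x -> ideal_gen rel2 x.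
Proof.
have [i0 iD iM] := ideal_gen_two_sided rel2.
move=> rel12; elim=> [//|x1 x2 _ I1 _ I2|a b l r /rel12 lr]; first exact: iD.
exact: iM.
Qed.

Lemma ideal_gen_mem rel l r : rel l r -> ideal_gen rel (l - r).
Proof.
move=> lr; have := ideal_gen_rel 1 1 lr.
by move: (l - r) => e; rewrite mul1r mulr1.
Qed.

End IdealGen.

Section UqTRelations.
Variables (F : fieldType) (q : F).
Local Notation Fr := (freealg F gen).
Variable I : Fr -> Prop.

Lemma UqT_rel_mod :
  (forall l r, UqT_rel q l r -> I (l - r)) <->
  UqT_mod q I (fun k => fgen F (gYp k)) (fun k => fgen F (gYm k))
    (shiftc q (fun k => fgen F (gZ k))) (shiftc q (fun k => fgen F (gZt k))).
Proof.
split=> [H|[H1 H2 H3 H4 H5 H6 H7 H8 H9 H10 H11 H12 H13 H14 H15 H16 H17] l r].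
  have H0 l : UqT_rel q l 0 -> I l by move/H; rewrite subr0.
  split.
  - by move=> k; apply: H; exact: UqT_y1_ym.
  - by move=> k; apply: H; exact: UqT_yp_y0.
  - by move=> k; apply: H; exact: UqT_y1_zt.
  - by move=> k; apply: H; exact: UqT_z_y1.
  - by move=> k; apply: H; exact: UqT_zt_y0.
  - by move=> k; apply: H; exact: UqT_y0_z.
  - by move=> k l; apply: H0; exact: UqT_yp_yp.
  - by move=> k l; apply: H0; exact: UqT_ym_ym.
  - by move=> k l; apply: H0; exact: UqT_yp_ym.
  - by move=> k l; apply: H0; exact: UqT_yp_zt.
  - by move=> k l; apply: H0; exact: UqT_yp_z.
  - by move=> k l; apply: H0; exact: UqT_ym_zt.
  - by move=> k l; apply: H0; exact: UqT_ym_z.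
  - by move=> k l; apply: H0; exact: UqT_zt_zt.
  - by move=> k l; apply: H0; exact: UqT_z_z.
  - by move=> k l; apply: H0; exact: UqT_z_zt.
  - by move=> n; apply: H0; exact: UqT_det.
case=> [k|k|k|k|k|k|k j|k j|k j|k j|k j|k j|k j|k j|k j|k j|n]; rewrite ?subr0.
- exact: H1.
- exact: H2.
- exact: H3.
- exact: H4.
- exact: H5.
- exact: H6.
- exact: H7.
- exact: H8.
- exact: H9.
- exact: H10.
- exact: H11.
- exact: H12.
- exact: H13.
- exact: H14.
- exact: H15.
- exact: H16.
exact: H17.
Qed.

End UqTRelations.

Lemma ideal_gen_UqT_FM (F : fieldType) (q kp km : F) :
    q != 0 -> q ^+ 2 - 1 != 0 -> q ^+ 2 + 1 != 0 -> 2 != 0 :> F ->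
    rhobar q = kp * km * (q + q^-1) ^+ 2 ->
  forall x, ideal_gen (UqT_rel q) x <-> ideal_gen (FM_rel q kp km) x.
Proof.
move=> q0 q1 q2 two0 hk x; split; apply: ideal_gen_le => l r.
  have idI := ideal_gen_two_sided (FM_rel q kp km); move: l r.
  apply/UqT_rel_mod.
  have FMr := (RKRK_modE (@fgen F gen) q0 q1 q2 two0 idI hk).1
    (fun i j n m => ideal_gen_mem (FM_RKRK q kp km i j m n)).
  have det := (qdet_modE q0 q1 q2 two0 idI hk FMr).1
    (fun n => ideal_gen_mem (FM_trace q kp km n)).
  exact: (UqT_modP q0 q1 q2 idI erefl erefl FMr det).
have idI := ideal_gen_two_sided (UqT_rel q).
have Um := (UqT_rel_mod q _).1 (fun l r => @ideal_gen_mem _ _ _ l r).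
have FMr := UqT_modW q0 q1 q2 idI erefl erefl Um.
case=> [i j m n|n].
  exact: ((RKRK_modE (@fgen F gen) q0 q1 q2 two0 idI hk).2 FMr).
exact: ((qdet_modE q0 q1 q2 two0 idI hk FMr).2 (UqT_detm Um)).
Qed.

Theorem theorem2p10 (R : realType) (kp km : Cq R)
    (hk : rhobar (qvar R) = kp * km * (qvar R + (qvar R)^-1) ^+ 2) :
  presented_by (@UqT_gen (Cq R) (qvar R)) (FM_rel (qvar R) kp km).
Proof.
have q0 : qvar R != 0 by rewrite tofrac_eq0 polyX_eq0.
have q1 : qvar R ^+ 2 - 1 != 0.
  rewrite /qvar -tofracXn -tofrac1 -tofracB tofrac_eq0 -[1]/(1%:P).
  by rewrite monic_neq0 // monicXnsubC.
have q2 : qvar R ^+ 2 + 1 != 0.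
  rewrite /qvar -tofracXn -tofrac1 -tofracD tofrac_eq0.
  by rewrite -[1]opprK -polyCN monic_neq0 // monicXnsubC.
have two0 : 2 != 0 :> Cq R.
  rewrite -[1]tofrac1 -tofracMn tofrac_eq0 -[1]/(1%:P) -polyCMn polyC_eq0.
  by rewrite pnatr_eq0.
have [surj ker] := UqT_presented (qvar R).
by split=> // x; rewrite ker; exact: ideal_gen_UqT_FM.
Qed.
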